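(* Let $p,q\ge1$ and let $T=(T_{i,j})_{i,j\ge 0}$ be a semi-infinite real banded matrix with $p$ subdiagonals and $q$ superdiagonals. Assume: (i) $T$ is bounded and there exists $s\ge 0$ such that $T+sI$ has a positive bidiagonal factorization $T+sI=L_1\cdots L_p\,D\,U_q\cdots U_1$. (ii) The sequences $\{A^{(1)}_n,\dots,A^{(p)}_n\}_{n=0}^\infty$ and $\{B^{(1)}_n,\dots,B^{(q)}_n\}_{n=0}^\infty$ of left and right recursion polynomials of $T$ are determined by the initial condition matrices $A_0\in\mathbb{R}^{p\times p}$ and $B_0\in\mathbb{R}^{q\times q}$, respectively, such that $A_0^{-1}=\Lambda\,\mathcal A$ and $B_0^{-1}=\mathcal B\,\Upsilon$, where $\mathcal A\in\mathbb{R}^{p\times p}$ is an upper unitriangular totally positive matrix, $\mathcal B\in\mathbb{R}^{q\times q}$ is a lower unitriangular totally positive matrix, and $\Lambda\in\mathbb{R}^{p\times p}$, $\Upsilon\in\mathbb{R}^{q\times q}$ are the triangular matrices with entries $$\Lambda_{i,j}=(L_1L_2\cdots L_j)_{i,0},\quad 0\le i,j\le p-1,\qquad \Upsilon_{i,j}=(U_iU_{i-1}\cdots U_1)_{0,j},\quad 0\le i,j\le q-1$$ (the empty product being the identity). Then there exist $pq$ nondecreasing positive functions $\psi_{b,a}$, $a\in\{1,\dots,p\}$, $b\in\{1,\dots,q\}$, and corresponding positive Lebesgue–Stieltjes measures $\mathrm{d}\psi_{b,a}$ with compact support $\Delta\subset\mathbb{R}$ such that the mixed multiple biorthogonality $$\sum_{a=1}^p\sum_{b=1}^q\int_\Delta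 B^{(b)}_l(x)\,\mathrm{d}\psi_{b,a}(x)\,A^{(a)}_k(x)=\delta_{k,l},\qquad k,l\in\mathbb{N}_0,$$ holds, and the degrees of these polynomials are $$\deg A_n^{(a)}=\left\lceil\frac{n+2-a}{p}\right\rceil-1,\qquad \deg B_n^{(b)}=\left\lceil\frac{n+2-b}{q}\right\rceil-1$$ for all $n\in\mathbb{N}_0$, $a\in\{1,\dots,p\}$, $b\in\{1,\dots,q\}$.
   Context: Banded with $p$ subdiagonals and $q$ superdiagonals means $T_{i,j}=0$ whenever $j>i+q$ or $i>j+p$; rows and columns are labelled by $\mathbb{N}_0$. Bounded means that $T$ defines a bounded operator (equivalently, for a banded matrix, the entries are uniformly bounded). A positive bidiagonal factorization (PBF) $L_1\cdots L_pDU_q\cdots U_1$ is one in which each $L_i$ is a semi-infinite lower bidiagonal matrix with ones on the diagonal and strictly positive entries everywhere on the first subdiagonal (zeros elsewhere), each $U_i$ is a semi-infinite upper bidiagonal matrix with ones on the diagonal and strictly positive entries everywhere on the first superdiagonal (zeros elsewhere), and $D$ is a semi-infinite diagonal matrix with strictly positive diagonal entries. An upper triangular matrix is called (upper triangular) totally positive if every minor with rows $i_1<\dots<i_r$ and columns $j_1<\dots<j_r$ satisfying $i_k\le j_k$ for all $k$ is positive; a lower triangular matrix is called (lower triangular) totally positive if every minor with $i_k\ge j_k$ for all $k$ is positive. Unitriangular means triangular with ones on the diagonal. Recursion polynomials: $A(x)=(A^{(a)}_n(x))$, $a\in\{1,\dots,p\}$ the row label and $n\in\mathbb{N}_0$ the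 column label, is the $p\times\infty$ matrix of polynomials with $A(x)T=xA(x)$ whose first $p\times p$ block $(A^{(a)}_n)_{a=1,\dots,p;\,n=0,\dots,p-1}$ is the constant invertible upper triangular matrix $A_0$. $B(x)=(B^{(b)}_n(x))$, $n\in\mathbb{N}_0$ the row label and $b\in\{1,\dots,q\}$ the column label, is the $\infty\times q$ matrix of polynomials with $TB(x)=xB(x)$ whose first $q\times q$ block $(B^{(b)}_n)_{n=0,\dots,q-1;\,b=1,\dots,q}$ is the constant invertible lower triangular matrix $B_0$. Convention: the zero polynomial has degree $-1$. *)

(* Defs.v *)
From HB Require Import structures.
From mathcomp Require Export all_boot all_order all_algebra.
From mathcomp Require Export all_classical all_reals all_analysis.
Export Order.TTheory GRing.Theory Num.Theory.
Export numFieldNormedType.Exports.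

Set Implicit Arguments.
Unset Strict Implicit.
Unset Printing Implicit Defensive.

Local Open Scope classical_set_scope.
Local Open Scope ring_scope.

Definition smx (R : Type) := nat -> nat -> R.

(* The sums over [set: nat] below are finitely supported sums (fsbigop): they
   are the genuine sums as soon as only finitely many terms are nonzero, which
   is the case for all the banded matrices they are used with. *)
Definition smx1 (R : realType) : smx R := fun i j => (i == j)%:R.

Definition smx_mul (R : realType) (M N : smx R) : smx R :=
  fun i j => \sum_(k \in [set: nat]) (M i k * N k j).

Definition smx_app (R : realType) (M : smx R) (x : nat -> R) : nat -> R :=
  fun i => \sum_(k \in [set: nat]) (M i k * x k).

Definition smx_shift (R : realType) (M : smx R) (s : R) : smx R :=
  fun i j => M i j + s * smx1 R i j.

Definition banded (R : realType) (p q : nat) (T : smx R) : Prop :=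
  forall i j, (i + q < j)%N || (j + p < i)%N -> T i j = 0.

Definition l2norm (R : realType) (x : nat -> R) : \bar R :=
  'N[@counting nat R]_(2%:E)[EFin \o x].

Definition bounded_operator (R : realType) (T : smx R) : Prop :=
  exists C : R, forall x : nat -> R, (l2norm x < +oo)%E ->
    (l2norm (smx_app T x) <= C%:E * l2norm x)%E.

Definition pos_lower_bidiagonal (R : realType) (M : smx R) : Prop :=
  [/\ forall i, M i i = 1,
      forall i, 0 < M i.+1 i &
      forall i j, j != i -> i != j.+1 -> M i j = 0].

Definition pos_upper_bidiagonal (R : realType) (M : smx R) : Prop :=
  [/\ forall i, M i i = 1,
      forall i, 0 < M i i.+1 &
      forall i j, j != i -> j != i.+1 -> M i j = 0].

Definition pos_diagonal (R : realType) (M : smx R) : Prop :=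
  (forall i, 0 < M i i) /\ (forall i j, i != j -> M i j = 0).

(* L_1 L_2 ... L_j *)
Definition Lprod (R : realType) (L : nat -> smx R) (j : nat) : smx R :=
  \big[@smx_mul R/smx1 R]_(1 <= k < j.+1) L k.

(* U_i U_(i-1) ... U_1 *)
Definition Uprod (R : realType) (U : nat -> smx R) (i : nat) : smx R :=
  \big[@smx_mul R/smx1 R]_(k <- rev (index_iota 1 i.+1)) U k.

(* The factors are numbered from 1; L 0, U 0 and those of index larger than
   p, resp. q, are irrelevant. *)
Definition is_PBF (R : realType) (p q : nat) (M : smx R)
    (L : nat -> smx R) (D : smx R) (U : nat -> smx R) : Prop :=
  [/\ forall i, (1 <= i <= p)%N -> pos_lower_bidiagonal (L i),
      pos_diagonal D,
      forall i, (1 <= i <= q)%N -> pos_upper_bidiagonal (U i) &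
      M = smx_mul (smx_mul (Lprod L p) D) (Uprod U q)].

Definition Lambda_mx (R : realType) (p : nat) (L : nat -> smx R) : 'M[R]_p :=
  \matrix_(i, j) Lprod L j i 0%N.

Definition Upsilon_mx (R : realType) (q : nat) (U : nat -> smx R) : 'M[R]_q :=
  \matrix_(i, j) Uprod U i 0%N j.

(* In MathComp, [is_trig_mx] means lower triangular. *)
Definition lower_triangular (R : realType) (n : nat) (M : 'M[R]_n) : Prop :=
  is_trig_mx M.

Definition upper_triangular (R : realType) (n : nat) (M : 'M[R]_n) : Prop :=
  is_trig_mx M^T.

Definition increasing_ord (r n : nat) (f : 'I_r -> 'I_n) : Prop :=
  forall k l : 'I_r, (k < l)%N -> (f k < f l)%N.

Definition upper_unitriangular_TP (R : realType) (n : nat) (M : 'M[R]_n) :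
    Prop :=
  [/\ upper_triangular M, forall i, M i i = 1 &
      forall (r : nat) (f g : 'I_r -> 'I_n),
        increasing_ord f -> increasing_ord g ->
        (forall k, (f k <= g k)%N) -> 0 < \det (mxsub f g M)].

Definition lower_unitriangular_TP (R : realType) (n : nat) (M : 'M[R]_n) :
    Prop :=
  [/\ lower_triangular M, forall i, M i i = 1 &
      forall (r : nat) (f g : 'I_r -> 'I_n),
        increasing_ord f -> increasing_ord g ->
        (forall k, (f k >= g k)%N) -> 0 < \det (mxsub f g M)].

(* The ordinal a stands for the label a + 1 of {1, ..., p}:
   [A a n] is A_n^(a+1); likewise [B n b] is B_n^(b+1). *)
Definition left_recursion_polys (R : realType) (p : nat) (T : smx R)
    (A0 : 'M[R]_p) (A : 'I_p -> nat -> {poly R}) : Prop :=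
  [/\ upper_triangular A0, A0 \in unitmx,
      forall a n : 'I_p, A a n = (A0 a n)%:P &
      forall (a : 'I_p) (n : nat),
        \sum_(m \in [set: nat]) (T m n *: A a m) = 'X * A a n].

Definition right_recursion_polys (R : realType) (q : nat) (T : smx R)
    (B0 : 'M[R]_q) (B : nat -> 'I_q -> {poly R}) : Prop :=
  [/\ lower_triangular B0, B0 \in unitmx,
      forall n b : 'I_q, B n b = (B0 n b)%:P &
      forall (n : nat) (b : 'I_q),
        \sum_(m \in [set: nat]) (T n m *: B m b) = 'X * B n b].

(* Integer-valued degree, with deg 0 = -1. *)
Definition degz (R : realType) (P : {poly R}) : int := (size P)%:Z - 1.

(* ceil ((n + 2 - c) / d) - 1, for a label c in {1, ..., d}. *)
Definition step_degree (n c d : nat) : int :=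
  Num.ceil ((n%:Z + 2 - c%:Z)%:~R / d%:R : rat) - 1.

(* Main.v *)
(* Total nonnegativity carries the whole argument. Every factor of
   S = T + s I is bidiagonal, hence totally nonnegative (TN), and by Cauchy-Binet
   products of TN matrices are TN.

   Degrees. Prepending the columns of A_0^-1 to S gives an upper triangular TN
   matrix K, and the leading coefficients of A^(a) in a window of length p solve a
   triangular system whose matrix is a product of diagonal p x p blocks of K; by
   Cramer's rule they are quotients of minors, which are positive.

   Measures. With v_a the a-th column of A_0^-1 and w_b the b-th row of B_0^-1,
   the functionals P |-> w_b P(T) v_a satisfy the biorthogonality, because
   sum_a A_k^(a)(T) v_a = e_k and sum_b w_b B_l^(b)(T) = e_l^t. They are nonnegative
   on squares: their Hankel matrices in powers of S are nonnegative combinations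
   of products of two TN Krylov matrices. As T is bounded, the moments grow at most
   geometrically, so the functionals are positive on products of powers of K + x
   and K - x, and limits of their Bernstein discretizations are integrals against
   positive measures. *)
From HB Require Import structures.
Require Import Defs.
From mathcomp Require Import all_fingroup.
From mathcomp Require Import ring lra zify.

Set Implicit Arguments.
Unset Strict Implicit.
Unset Printing Implicit Defensive.

Local Open Scope classical_set_scope.
Local Open Scope ring_scope.

(** * The Cauchy-Binet formula and total nonnegativity *)

(** The moments need only nonnegative minors, but the degrees need strict positivity. The strict
    information carried along is small: principal minors, and minors whose row and column indices
    differ by at most one, always in the same direction. This is the family that Cramer's rule
    produces. A column of Lambda is the first column V e_0 of a left factor of S = V V'. This makes
    each column of its Krylov matrix computable from the previous one by TN factors. The same holds
    for the transpose of S, with a left factor that need not match V. T itself need not be TN. The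
    substitution X - s replaces it by S and maps squares to squares. Positivity on squares alone
    says nothing about K + X and K - X; the growth of the moments does. If |L X| exceeded K L(1),
    repeated use of Cauchy-Schwarz would make L X^(2^k) outgrow C K^(2^k). Applied to all
    functionals weighted by a square, this shows that multiplication by K + X or K - X preserves the
    hypotheses with the same K. *)

Lemma det_rowsub_perm (R : comPzRingType) (r n : nat) (B : 'M[R]_(n, r))
    (h : 'I_r -> 'I_n) (s : 'S_r) :
  \det (rowsub (h \o s) B) = (-1) ^+ s * \det (rowsub h B).
Proof.
rewrite -det_perm -det_mulmx -row_permE; congr (\det _).
by apply/matrixP => i j; rewrite !mxE.
Qed.

Lemma det_colsub_perm (R : comPzRingType) (r n : nat) (A : 'M[R]_(r, n))
    (h : 'I_r -> 'I_n) (s : 'S_r) :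
  \det (colsub (h \o s) A) = (-1) ^+ s * \det (colsub h A).
Proof.
rewrite -det_tr -[in RHS]det_tr.
have E k : (colsub k A)^T = rowsub k A^T by apply/matrixP => i j; rewrite !mxE.
by rewrite !E det_rowsub_perm.
Qed.

(** Multilinearity in the rows only; antisymmetrization over the maps is what [cauchy_binet]
    adds. *)
Lemma det_mulmx_rowsub (R : comPzRingType) (r n : nat)
    (A : 'M[R]_(r, n)) (B : 'M[R]_(n, r)) :
  \det (A *m B) =
  \sum_(h : {ffun 'I_r -> 'I_n}) (\prod_i A i (h i)) * \det (rowsub h B).
Proof.
transitivity (\sum_(h : {ffun 'I_r -> 'I_n}) \sum_(s : 'S_r)
    (-1) ^+ s * \prod_i (A i (h i) * B (h i) (s i))).
  rewrite exchange_big; apply: eq_bigr => /= s _; rewrite -big_distrr /=.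
  congr (_ * _); rewrite -(bigA_distr_bigA (fun i j => A i j * B j (s i))) /=.
  by apply: eq_bigr => x _; rewrite mxE.
apply: eq_bigr => h _; rewrite /determinant mulr_sumr; apply: eq_bigr => s _.
rewrite big_split /= mulrCA; congr (_ * (_ * _)).
by apply: eq_bigr => i _; rewrite !mxE.
Qed.

(* Summing over all maps instead of the increasing ones only counts each
   minor [r`!] times. *)
Lemma cauchy_binet (R : comPzRingType) (r n : nat)
    (A : 'M[R]_(r, n)) (B : 'M[R]_(n, r)) :
  \det (A *m B) *+ r`! =
  \sum_(h : {ffun 'I_r -> 'I_n}) \det (colsub h A) * \det (rowsub h B).
Proof.
transitivity (\sum_(h : {ffun 'I_r -> 'I_n}) \sum_(s : 'S_r)
    (-1) ^+ s * \prod_i A i (h (s i)) * \det (rowsub h B)); last first.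
  apply: eq_bigr => h _; rewrite /determinant mulr_suml; apply: eq_bigr => s _.
  congr (_ * _ * _).
  by apply: eq_bigr => i _; rewrite !mxE.
(* The factorial is spent on one copy of [\det (A *m B)] per permutation [s]. Reindexing by
   composition with [s] turns that copy into the [s]-part of the Leibniz expansion of the minors of
   [A]. *)
rewrite exchange_big /= -[in LHS]card_Sn -sumr_const.
apply: eq_big => [s | s _]; first by rewrite !inE.
rewrite det_mulmx_rowsub.
pose c (t : 'S_r) (h : {ffun 'I_r -> 'I_n}) := [ffun i => h (t i)].
have ck t : cancel (c t) (c (t^-1)%g).
  by move=> h; apply/ffunP => i; rewrite !ffunE permKV.
have ckv t : cancel (c (t^-1)%g) (c t).
  by move=> h; apply/ffunP => i; rewrite !ffunE permK.
rewrite (reindex (c s)) /=; last by exists (c (s^-1)%g) => h _; rewrite ?ck ?ckv.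
apply: eq_bigr => h _.
have -> : rowsub (c s h) B = rowsub (h \o s) B.
  by apply/matrixP => i j; rewrite !mxE ffunE.
rewrite det_rowsub_perm mulrA; congr (_ * _); rewrite mulrC; congr (_ * _).
by apply: eq_bigr => i _; rewrite ffunE.
Qed.

Lemma fsum_ord (V : nmodType) (F : nat -> V) n : (forall k, (n <= k)%N -> F k = 0) ->
  \sum_(k \in [set: nat]) F k = \sum_(k < n) F k.
Proof.
move=> H; rewrite fsbig_ord; apply/esym/fsbig_widen => //.
by move=> k [_ /= /negP]; rewrite -leqNgt => /H.
Qed.

Section Minors.
Variable R : realType.
Implicit Types (M N : smx R) (f g h : nat -> nat).

(** Row and column choices are functions on all of [nat], of which the first [r] values count, so
    that shifts and windows require no casts. *)
Definition minor (r : nat) f g M : R :=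
  \det (\matrix_(i < r, j < r) M (f i) (g j)).

Definition sinc (r : nat) f :=
  forall i j, (i < j)%N -> (j < r)%N -> (f i < f j)%N.

Definition smx_tr M : smx R := fun i j => M j i.

Lemma minor_tr r f g M : minor r f g (smx_tr M) = minor r g f M.
Proof. by rewrite /minor -det_tr; congr (\det _); apply/matrixP => i j; rewrite !mxE. Qed.

Lemma eq_minor r f g f' g' M M' :
  (forall i j, (i < r)%N -> (j < r)%N -> M (f i) (g j) = M' (f' i) (g' j)) ->
  minor r f g M = minor r f' g' M'.
Proof. by move=> H; congr (\det _); apply/matrixP => i j; rewrite !mxE H. Qed.

Lemma sinc_lt r f : sinc r.+1 f -> sinc r f.
Proof. by move=> H i j ij jr; apply: H => //; apply: ltnW. Qed.

Lemma sinc_shift r f : sinc r.+1 f -> sinc r (fun i => f i.+1).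
Proof. by move=> H i j ij jr; apply: H. Qed.

(** Row-finiteness turns the finitely supported products into genuine sums; associativity rests on
    it. *)
Definition rfin M := forall i, exists n, forall k, (n <= k)%N -> M i k = 0.

Lemma rfin_unif M r f : rfin M ->
  exists n, forall i, (i < r)%N -> forall k, (n <= k)%N -> M (f i) k = 0.
Proof.
move=> fM; elim: r => [|r [n Hn]]; first by exists 0%N.
have [m Hm] := fM (f r); exists (maxn m n) => i; rewrite ltnS leq_eqVlt.
move=> /predU1P[->|ir] k; rewrite geq_max => /andP[mk nk]; first exact: Hm.
exact: Hn.
Qed.

Lemma smx_mulE M N i j n : (forall k, (n <= k)%N -> M i k = 0) ->
  smx_mul M N i j = \sum_(k < n) M i k * N k j.
Proof. by move=> H; apply: fsum_ord => k nk; rewrite H// mul0r. Qed.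

(** The column bound [c] serves [TN_krylov], where nonnegativity spreads one column at a time.
    Ordinary total nonnegativity is [forall c, TN c M]. *)
Definition TN (c : nat) M := forall r f g, sinc r f -> sinc r g ->
  (forall j, (j < r)%N -> (g j < c)%N) -> 0 <= minor r f g M.

Lemma inj_sort r n (h : 'I_r -> 'I_n) : injective h ->
  exists (h' : nat -> nat) (s : 'S_r), [/\ sinc r h',
    forall i, (i < r)%N -> (h' i < n)%N & forall i, h' (s i) = h i].
Proof.
move=> hi; pose t := [tuple nat_of_ord (h i) | i < r].
have ut : uniq t by rewrite map_inj_uniq ?enum_uniq// => i j /ord_inj /hi.
pose u := sort leq t.
have su : size u = r by rewrite size_sort size_tuple.
pose tu := @Tuple r nat u (introT eqP su).
have /tuple_permP[s Es] : perm_eq t tu by rewrite perm_sym /= perm_sort.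
exists (nth 0%N u), s; split.
- move=> i j ij jr.
  have : sorted ltn u.
    by rewrite ltn_sorted_uniq_leq sort_uniq ut sort_sorted//; exact: leq_total.
  move=> /(sorted_ltn_nth ltn_trans 0%N); apply; rewrite ?inE ?su //.
  exact: ltn_trans jr.
- move=> i ir; have : nth 0%N u i \in t by rewrite -(mem_sort leq) mem_nth ?su.
  by move=> /mapP[k _ ->].
- move=> i; rewrite -(tnth_nth 0%N tu).
  have := congr1 (fun x => tnth x i) (val_inj Es : t = [tuple tnth tu (s j) | j < r]).
  by rewrite !tnth_mktuple.
Qed.

Lemma minor_mulE r f g M N n :
  (forall i, (i < r)%N -> forall k, (n <= k)%N -> M (f i) k = 0) ->
  minor r f g (smx_mul M N) =
  \det ((\matrix_(i < r, k < n) M (f i) k) *m (\matrix_(k < n, j < r) N k (g j))).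
Proof.
move=> H; congr (\det _); apply/matrixP => i j; rewrite !mxE (@smx_mulE _ _ _ _ n).
  by apply: eq_bigr => k _; rewrite !mxE.
exact: H.
Qed.

(** A non-injective [h] repeats a row. An injective one is an increasing choice followed by a
    permutation, whose sign occurs in both factors and cancels. *)
Lemma cauchy_binet_term r n f g M N c (h : {ffun 'I_r -> 'I_n}) :
  (forall c, TN c M) -> TN c N -> sinc r f -> sinc r g ->
  (forall j, (j < r)%N -> (g j < c)%N) ->
  0 <= \det (colsub h (\matrix_(i < r, k < n) M (f i) k)) *
       \det (rowsub h (\matrix_(k < n, j < r) N k (g j))).
Proof.
move=> tM tN sf sg gc.
have [hi|/injectivePn[i1 [i2 Di12 Ef12]]] := boolP (injectiveb h); last first.
  rewrite [X in _ * X](determinant_alternate Di12) ?mulr0// => j.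
  by rewrite !mxE Ef12.
have [h' [s [sh' h'n Eh]]] := inj_sort (injectiveP _ hi).
pose k := fun i : 'I_r => Ordinal (h'n _ (ltn_ord i)).
have Ek : h =1 k \o s by move=> i; apply: val_inj; rewrite /= Eh.
have -> : colsub h (\matrix_(i < r, k < n) M (f i) k) =
   colsub (k \o s) (\matrix_(i < r, k < n) M (f i) k).
  by apply/matrixP => i j; rewrite !mxE Ek.
have -> : rowsub h (\matrix_(k < n, j < r) N k (g j)) =
   rowsub (k \o s) (\matrix_(k < n, j < r) N k (g j)).
  by apply/matrixP => i j; rewrite !mxE Ek.
rewrite det_colsub_perm det_rowsub_perm mulrACA -expr2 sqrr_sign mul1r.
apply: mulr_ge0.
  have -> : colsub k (\matrix_(i < r, k < n) M (f i) k) =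
     \matrix_(i < r, j < r) M (f i) (h' j) by apply/matrixP => i j; rewrite !mxE.
  exact: (tM n).
have -> : rowsub k (\matrix_(k < n, j < r) N k (g j)) =
     \matrix_(i < r, j < r) N (h' i) (g j) by apply/matrixP => i j; rewrite !mxE.
exact: tN.
Qed.

Lemma TN_mul c M N : rfin M -> (forall c, TN c M) -> TN c N -> TN c (smx_mul M N).
Proof.
move=> rM tM tN r f g sf sg gc.
have [n Hn] := rfin_unif r f rM.
rewrite (minor_mulE g N Hn).
suff: 0 <= \det (\matrix_(i < r, k < n) M (f i) k *m
   \matrix_(k < n, j < r) N k (g j)) *+ r`! by rewrite pmulrn_lge0 ?fact_gt0.
by rewrite cauchy_binet sumr_ge0// => h _; exact: (cauchy_binet_term _ tM tN).
Qed.

(** All Cauchy-Binet terms are nonnegative, so the single positive term indexed by [h] decides the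
    sign. *)
Lemma minor_mul_gt0 c r f g h M N : rfin M -> (forall c, TN c M) -> TN c N ->
  sinc r f -> sinc r g -> (forall j, (j < r)%N -> (g j < c)%N) ->
  0 < minor r f h M -> 0 < minor r h g N -> 0 < minor r f g (smx_mul M N).
Proof.
move=> rM tM tN sf sg gc Mfh Nhg.
have [n0 Hn0] := rfin_unif r f rM.
pose n := maxn n0 (\max_(i < r) (h i).+1).
have Hn i : (i < r)%N -> forall k, (n <= k)%N -> M (f i) k = 0.
  by move=> ir k nk; apply: Hn0 => //; apply: leq_trans nk; exact: leq_maxl.
have hn i : (i < r)%N -> (h i < n)%N.
  move=> ir; rewrite leq_max; apply/orP; right.
  exact: (@leq_bigmax _ (fun i : 'I_r => (h i).+1) (Ordinal ir)).
rewrite (minor_mulE g N Hn).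
suff: 0 < \det (\matrix_(i < r, k < n) M (f i) k *m
   \matrix_(k < n, j < r) N k (g j)) *+ r`! by rewrite pmulrn_lgt0 ?fact_gt0.
rewrite cauchy_binet.
rewrite (bigD1 [ffun i : 'I_r => Ordinal (hn _ (ltn_ord i))]) //=.
rewrite ltr_wpDr//.
  by apply: sumr_ge0 => k _; exact: (cauchy_binet_term _ tM tN).
apply: mulr_gt0; [move: Mfh | move: Nhg]; congr (0 < \det _);
  by apply/matrixP => i j; rewrite !mxE ffunE.
Qed.

End Minors.

(** * Bidiagonal matrices and products of semi-infinite matrices *)

Section Expansion.
Variable R : realType.
Implicit Types (M N : smx R) (f g h : nat -> nat).

Lemma minor0 f g M : minor 0 f g M = 1.
Proof. exact: det_mx00. Qed.

Lemma minor_row0 r f g M :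
  (forall j, (0 < j <= r)%N -> M (f 0%N) (g j) = 0) ->
  minor r.+1 f g M =
  M (f 0%N) (g 0%N) * minor r (fun i => f i.+1) (fun i => g i.+1) M.
Proof.
move=> H; rewrite /minor (expand_det_row _ ord0) big_ord_recl big1 ?addr0.
  rewrite !mxE /cofactor /= expr0 mul1r; congr (_ * \det _).
  by apply/matrixP => i j; rewrite !mxE.
by move=> j _; rewrite !mxE H ?mul0r//= /bump /= add1n ltnS ltn_ord.
Qed.

Lemma minor_col0 r f g M :
  (forall i, (0 < i <= r)%N -> M (f i) (g 0%N) = 0) ->
  minor r.+1 f g M =
  M (f 0%N) (g 0%N) * minor r (fun i => f i.+1) (fun i => g i.+1) M.
Proof.
by move=> H; rewrite -(minor_tr _ g f) (@minor_row0 _ g f (smx_tr M) H) (minor_tr _ (fun i => g i.+1)).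
Qed.

Lemma minor_row_last r f g M :
  (forall j, (j < r)%N -> M (f r) (g j) = 0) ->
  minor r.+1 f g M = minor r f g M * M (f r) (g r).
Proof.
move=> H; rewrite /minor (expand_det_row _ ord_max) big_ord_recr big1 ?add0r.
  rewrite [RHS]mulrC !mxE /cofactor /= exprD -expr2 sqrr_sign mul1r.
  by rewrite add0r; congr (_ * \det _); apply/matrixP => i j; rewrite !mxE !lift_max.
by move=> j _; rewrite !mxE H ?mul0r/=.
Qed.

Lemma minor_col_last r f g M :
  (forall i, (i < r)%N -> M (f i) (g r) = 0) ->
  minor r.+1 f g M = minor r f g M * M (f r) (g r).
Proof.
by move=> H; rewrite -(minor_tr _ g f) (@minor_row_last _ g f (smx_tr M) H) (minor_tr _ g f).
Qed.

(** The subdiagonal may vanish, so that [D] and the identity are covered too. *)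
Definition lower_bidiag M := [/\ forall i, 0 < M i i, forall i, 0 <= M i.+1 i &
  forall i j, j != i -> i != j.+1 -> M i j = 0].

(* A minor of a lower bidiagonal matrix reduces to its diagonal product,
   because its first row or its first column has at most one nonzero entry. *)
Lemma minor_bidiag r f g M : lower_bidiag M -> sinc r f -> sinc r g ->
  minor r f g M = \prod_(i < r) M (f i) (g i).
Proof.
move=> [_ _ z]; elim: r f g => [|r IH] f g sf sg; first by rewrite minor0 big_ord0.
rewrite big_ord_recl -(IH (fun i => f i.+1) (fun i => g i.+1)); try exact: sinc_shift.
have [fg|gf] := leqP (f 0%N) (g 0%N).
  rewrite minor_row0// => j /andP[j0 jr]; have := sg 0%N j j0 jr => H.
  by apply: z; lia.
rewrite minor_col0// => j /andP[j0 jr]; have := sf 0%N j j0 jr => H.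
by apply: z; lia.
Qed.

Lemma bidiag_ge0 M i j : lower_bidiag M -> 0 <= M i j.
Proof.
move=> [d s z]; have [->|ji] := eqVneq j i; first exact: ltW.
by have [->//|ij] := eqVneq i j.+1; rewrite z.
Qed.

(** Both finiteness conditions are kept for stability under products and transposition. Positive
    principal minors let a positive minor of one factor survive multiplication by another factor,
    with [h = f] or [h = g] in [minor_mul_gt0]. *)
Definition pTN M := [/\ rfin M, rfin (smx_tr M), forall c, TN c M &
  forall r f, sinc r f -> 0 < minor r f f M].

Lemma bidiag_pTN M : lower_bidiag M -> pTN M.
Proof.
move=> bM; have [d s z] := bM; split.
- by move=> i; exists i.+1 => k ik; apply: z; lia.
- by move=> i; exists i.+2 => k ik; apply: z; lia.
- move=> c r f g sf sg _; rewrite minor_bidiag//.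
  by apply: prodr_ge0 => i _; exact: bidiag_ge0.
- by move=> r f sf; rewrite minor_bidiag// prodr_gt0.
Qed.

Lemma sinc_bound r g : exists c, forall j, (j < r)%N -> (g j < c)%N.
Proof.
exists (\max_(i < r) (g i).+1) => j jr.
exact: (@leq_bigmax _ (fun i : 'I_r => (g i).+1) (Ordinal jr)).
Qed.

Lemma pTN_tr M : pTN M -> pTN (smx_tr M).
Proof.
move=> [a b t d]; split => //.
  move=> c r f g sf sg _; rewrite minor_tr.
  by have [e /t] := sinc_bound r f; exact.
by move=> r f sf; rewrite minor_tr; exact: d.
Qed.

Lemma smx_tr_mul M N : smx_tr (smx_mul M N) = smx_mul (smx_tr N) (smx_tr M).
Proof.
apply/funext => i; apply/funext => j; rewrite /smx_tr /smx_mul.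
by apply: eq_fsbigr => k _; rewrite mulrC.
Qed.

Lemma rfin_mul M N : rfin M -> rfin N -> rfin (smx_mul M N).
Proof.
move=> fM fN i; have [n Hn] := fM i; have [m Hm] := rfin_unif n id fN.
exists m => k mk; rewrite (smx_mulE _ _ Hn) big1// => l _.
by rewrite Hm ?mulr0.
Qed.

Lemma smx_mulA M N P : rfin M -> rfin N ->
  smx_mul M (smx_mul N P) = smx_mul (smx_mul M N) P.
Proof.
move=> fM fN; apply/funext => i; apply/funext => j.
have [n Hn] := fM i; have [m Hm] := rfin_unif n id fN.
rewrite (smx_mulE _ _ Hn).
transitivity (\sum_(k < n) \sum_(l < m) M i k * (N k l * P l j)).
  by apply: eq_bigr => k _; rewrite (@smx_mulE _ _ _ _ _ m) ?mulr_sumr// => l; exact: Hm.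
rewrite (@smx_mulE _ _ _ _ _ m) => [|k mk].
  rewrite exchange_big; apply: eq_bigr => l _ /=.
  by rewrite (smx_mulE _ _ Hn) mulr_suml; apply: eq_bigr => k _; rewrite mulrA.
by rewrite (smx_mulE _ _ Hn) big1// => l _; rewrite Hm ?mulr0.
Qed.

Lemma smx_mul1l M : smx_mul (@smx1 R) M = M.
Proof.
apply/funext => i; apply/funext => j; rewrite (@smx_mulE _ _ _ _ _ i.+1).
  rewrite big_ord_recr /= big1 ?add0r /smx1 ?eqxx ?mul1r// => k _.
  by rewrite gtn_eqF ?mul0r.
by move=> k ik; rewrite /smx1 ltn_eqF.
Qed.

Lemma smx_tr1 : smx_tr (@smx1 R) = @smx1 R.
Proof. by apply/funext => i; apply/funext => j; rewrite /smx_tr /smx1 eq_sym. Qed.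

Lemma smx_trK M : smx_tr (smx_tr M) = M.
Proof. by []. Qed.

Lemma smx_mul1r M : smx_mul M (@smx1 R) = M.
Proof. by rewrite -[LHS]smx_trK smx_tr_mul smx_tr1 smx_mul1l. Qed.

Lemma pTN1 : pTN (@smx1 R).
Proof.
apply: bidiag_pTN; split => [i|i|i j]; rewrite /smx1 ?eqxx ?ler0n//.
by rewrite eq_sym => /negPf ->.
Qed.

Lemma pTN_mul M N : pTN M -> pTN N -> pTN (smx_mul M N).
Proof.
move=> [a b t d] [a' b' t' d']; split.
- exact: rfin_mul.
- by rewrite smx_tr_mul; exact: rfin_mul.
- by move=> c; exact: TN_mul.
- move=> r f sf; have [c fc] := sinc_bound r f.
  by apply: (@minor_mul_gt0 _ c _ _ _ f) => //; [exact: d | exact: d'].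
Qed.

Definition lprod (s : seq (smx R)) : smx R := foldr (@smx_mul R) (@smx1 R) s.

Definition all_smx (P : smx R -> Prop) s := forall i, (i < size s)%N -> P (nth (@smx1 R) s i).

Lemma all_smx_cons P M s : all_smx P (M :: s) <-> P M /\ all_smx P s.
Proof.
split=> [H|[HM Hs] [|i]//]; last by rewrite /= ltnS; exact: Hs.
by split; [exact: (H 0%N) | move=> i; exact: (H i.+1)].
Qed.

Lemma lprod_pTN s : all_smx pTN s -> pTN (lprod s).
Proof.
elim: s => [|M s IH]; first by move=> _; exact: pTN1.
by move=> /all_smx_cons[pM /IH ps] /=; exact: pTN_mul.
Qed.

Lemma lprod_cat s t : all_smx pTN s -> all_smx pTN t ->
  lprod (s ++ t) = smx_mul (lprod s) (lprod t).
Proof.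
elim: s => [|M s IH]; first by rewrite smx_mul1l.
move=> /all_smx_cons[pM ps] pt /=; rewrite IH// smx_mulA//; first by case: pM.
by case: (lprod_pTN ps).
Qed.

Lemma all_smx_catP P s t : all_smx P (s ++ t) <-> all_smx P s /\ all_smx P t.
Proof.
elim: s => [|M s IH]; first by split => [|[]//]; split.
rewrite cat_cons !all_smx_cons IH; tauto.
Qed.

Lemma all_smx_rev P s : all_smx P s -> all_smx P (rev s).
Proof.
move=> H i; rewrite size_rev => si; rewrite nth_rev//; apply: H.
by rewrite subnSK// leq_subr.
Qed.

Lemma all_smx_map P Q F s : (forall M, P M -> Q (F M)) -> all_smx P s -> all_smx Q (map F s).
Proof.
by move=> PQ H i; rewrite size_map => si; rewrite (nth_map (@smx1 R))//; apply/PQ/H.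
Qed.

Lemma lprod_tr s : all_smx pTN s -> smx_tr (lprod s) = lprod (rev (map (@smx_tr R) s)).
Proof.
elim: s => [|M s IH]; first by rewrite /= smx_tr1.
move=> /all_smx_cons[pM ps] /=; rewrite smx_tr_mul IH// rev_cons -cats1 lprod_cat.
- by rewrite /= smx_mul1r.
- by apply: all_smx_rev; exact: (all_smx_map (@pTN_tr) ps).
- by apply/(@all_smx_cons (@pTN)); split => //; exact: pTN_tr.
Qed.

End Expansion.

(** * Staircase and Krylov matrices *)

(** The zero block has [r - k] rows and [k + 1] columns, together more than [r], so by the
    pigeonhole principle every permutation meets it. *)
Lemma det_corner0 (R : comPzRingType) (r : nat) (A : 'M[R]_r) (k : 'I_r) :
  (forall i j : 'I_r, (k <= i)%N -> (j <= k)%N -> A i j = 0) -> \det A = 0.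
Proof.
move=> A0; rewrite /determinant big1// => s _.
suff [i ki sik] : exists2 i : 'I_r, (k <= i)%N & (s i <= k)%N.
  by rewrite (bigD1 i)//= A0// mul0r mulr0.
apply: contrapT => H; pose S := [set i : 'I_r | (k <= i)%N]%SET.
have kS : k \in S by rewrite inE.
have sub : (s @: S)%SET \subset (S :\ k)%SET.
  apply/fintype.subsetP => _ /imsetP[i + ->]; rewrite !inE => ki.
  have [ski|ksi] := leqP (s i) k; first by exfalso; apply: H; exists i.
  by rewrite (ltnW ksi) andbT; apply: contraTneq ksi => ->; rewrite ltnn.
have := subset_leq_card sub; rewrite card_imset; last exact: perm_inj.
by rewrite [leqLHS](cardsD1 k) kS ltnn.
Qed.

Section Staircase.
Variable R : realType.
Implicit Types (M N V W : smx R) (f g h : nat -> nat).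

Definition smx_pre M : smx R :=
  fun i j => if j is j'.+1 then M i j' else (i == 0%N)%:R.

Lemma minor_pre r f g M : (forall j, (j < r)%N -> (0 < g j)%N) ->
  minor r f g (smx_pre M) = minor r f (fun j => (g j).-1) M.
Proof. by move=> g0; apply: eq_minor => i j _ /g0; case: (g j). Qed.

Lemma minor_pre0 r f g M : sinc r.+1 f -> sinc r.+1 g -> g 0%N = 0%N ->
  minor r.+1 f g (smx_pre M) =
  (f 0%N == 0%N)%:R * minor r (fun i => f i.+1) (fun j => (g j.+1).-1) M.
Proof.
move=> sf sg g0; rewrite minor_col0 => [|i /andP[i0 ir]].
  by rewrite g0/= minor_pre// => j jr; have := sg 0%N j.+1 isT jr; rewrite g0.
by have := sf 0%N i i0 ir; rewrite g0/=; case: (f i).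
Qed.

Lemma sinc_pred r g : (forall j, (j < r)%N -> (0 < g j)%N) -> sinc r g ->
  sinc r (fun j => (g j).-1).
Proof.
move=> g0 sg i j ij jr; have := sg i j ij jr; have := g0 i (ltn_trans ij jr).
by case: (g i) => // a _; case: (g j).
Qed.

Lemma sinc_gt0 r g : sinc r g -> (0 < g 0%N)%N ->
  forall j, (j < r)%N -> (0 < g j)%N.
Proof. by move=> sg g0 [//|j jr]; apply: leq_ltn_trans (sg 0%N j.+1 isT jr). Qed.

(** The new column is [e_0], so a minor that uses it is 0 or a smaller minor of [M]. The gain from
    [c] to [c.+1] drives the induction of [TN_krylov]. *)
Lemma TN_pre c M : TN c M -> TN c.+1 (smx_pre M).
Proof.
move=> tM [|r] f g sf sg gc; first by rewrite minor0.
have [g0|g0] := posnP (g 0%N); last first.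
  have gp := sinc_gt0 sg g0; rewrite minor_pre//; apply: tM => //.
    exact: sinc_pred.
  by move=> j jr; have := gc j jr; have := gp j jr; case: (g j).
rewrite minor_pre0// mulr_ge0//.
have gp j : (j < r)%N -> (0 < g j.+1)%N.
  by move=> jr; have := sg 0%N j.+1 isT jr; rewrite g0.
apply: tM; first exact: sinc_shift.
  exact: (sinc_pred gp (sinc_shift sg)).
by move=> j jr; have := gc j.+1 jr; have := gp j jr; case: (g j.+1).
Qed.

Lemma TN_pre_all M : (forall c, TN c M) -> forall c, TN c (smx_pre M).
Proof.
move=> tM c r f g sf sg gc; apply: (TN_pre (tM c)) => // j jr.
by rewrite ltnS ltnW// gc.
Qed.

(* The Krylov matrix with columns S^m V e_0, for S = V V', satisfies
   [C = V (e_0 | V' C)]. *)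
Lemma TN_krylov V V' C : rfin V -> rfin V' -> (forall c, TN c V) ->
  (forall c, TN c V') -> C = smx_mul V (smx_pre (smx_mul V' C)) ->
  forall c, TN c C.
Proof.
move=> fV fV' tV tV' EC; elim => [|c IH].
  by move=> [|r] f g _ _; [rewrite minor0|move=> /(_ 0%N isT)].
by rewrite EC; apply: TN_mul => //; apply: TN_pre; exact: TN_mul.
Qed.

(** The deletion of one row and of the first column in Cramer's rule yields exactly such index
    pairs, see [upper_TN_solution_neq0]. *)
Definition up_pos M := forall r f g, sinc r f -> sinc r g ->
  (forall k, (k < r)%N -> g k = f k \/ g k = (f k).+1) -> 0 < minor r f g M.

Definition low_pos M := forall r f g, sinc r f -> sinc r g ->
  (forall k, (k < r)%N -> g k = f k \/ f k = (g k).+1) -> 0 < minor r f g M.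

(** Prepending shifts the columns by one: the subdiagonal of [M] becomes the diagonal, and its
    diagonal the superdiagonal. *)
Lemma up_pos_pre M : low_pos M -> up_pos (smx_pre M).
Proof.
move=> lM [|r] f g sf sg fg; first by rewrite minor0.
have [g0|g0] := posnP (g 0%N); last first.
  have gp := sinc_gt0 sg g0; rewrite minor_pre//; apply: lM => //.
    exact: sinc_pred.
  by move=> k kr; have := fg k kr; have := gp k kr; lia.
rewrite minor_pre0//; have := fg 0%N isT; rewrite g0 => -[<-|//].
have gp j : (j < r)%N -> (0 < g j.+1)%N.
  by move=> jr; have := sg 0%N j.+1 isT jr; rewrite g0.
rewrite mul1r; apply: lM; first exact: sinc_shift.
  exact: (sinc_pred gp (sinc_shift sg)).
by move=> k kr; have := fg k.+1 kr; have := gp k kr; lia.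
Qed.

Definition pos_lower_bd M := lower_bidiag M /\ forall i, 0 < M i.+1 i.

Lemma low_pos_bidiag M : pos_lower_bd M -> low_pos M.
Proof.
move=> [bM sM] r f g sf sg fg; rewrite minor_bidiag//; apply: prodr_gt0 => i _.
by have [d _ _] := bM; have [->|->] := fg i (ltn_ord i).
Qed.

Lemma low_pos_mul M N : rfin M -> (forall c, TN c M) -> low_pos M -> pTN N ->
  low_pos (smx_mul M N).
Proof.
move=> rM tM lM [_ _ tN dN] r f g sf sg fg; have [c gc] := sinc_bound r g.
by apply: (@minor_mul_gt0 _ c _ _ _ g) => //; [exact: lM | exact: dN].
Qed.

Lemma rfin_pre M : rfin M -> rfin (smx_pre M).
Proof. by move=> fM i; have [n H] := fM i; exists n.+1 => -[//|k]; exact: H. Qed.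

Lemma crfin_pre M : rfin (smx_tr M) -> rfin (smx_tr (smx_pre M)).
Proof.
move=> fM [|j]; first by exists 1%N => -[].
by have [n H] := fM j; exists n => k; exact: H.
Qed.

(** For factors M_1, ..., M_p the columns are e_0, M_1 e_0, ..., M_1 ... M_(p-1) e_0, followed by
    those of M_1 ... M_p W. The nested form makes positivity inductive; the unfolded one, [stairE],
    exhibits Lambda next to S. *)
Fixpoint stair (s : seq (smx R)) W : smx R :=
  if s is M :: s' then smx_pre (smx_mul M (stair s' W)) else W.

Lemma pos_lower_bd_pTN M : pos_lower_bd M -> pTN M.
Proof. by case=> bM _; exact: bidiag_pTN. Qed.

Lemma stair_pTN s W : all_smx pos_lower_bd s -> pTN W -> pTN (stair s W).
Proof.
elim: s => [//|M s IH] /all_smx_cons[bM bs] pW; have pZ := IH bs pW.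
have pM := pos_lower_bd_pTN bM; have [a b c d] := pTN_mul pM pZ.
split => /=; first exact: rfin_pre.
- exact: crfin_pre.
- exact: TN_pre_all.
- move=> r f sf; apply: up_pos_pre => //; last by left.
  by apply: low_pos_mul => //; [case: pM | case: pM | exact: low_pos_bidiag].
Qed.

Lemma stair_up_pos s W : all_smx pos_lower_bd s -> (0 < size s)%N -> pTN W ->
  up_pos (stair s W).
Proof.
case: s => [//|M s] /all_smx_cons[bM bs] _ pW; have pZ := stair_pTN bs pW.
have pM := pos_lower_bd_pTN bM.
by apply/up_pos_pre/low_pos_mul => //; [case: pM | case: pM | exact: low_pos_bidiag].
Qed.

Lemma stairE (s : seq (smx R)) W i j : all_smx (@pTN R) s -> pTN W -> stair s W i j =
  if (j < size s)%N then lprod (take j s) i 0%N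
  else smx_mul (lprod s) W i (j - size s)%N.
Proof.
move=> ps pW; elim: s ps i j => [_ i j|M s IH].
  by rewrite /= subn0 smx_mul1l.
move=> /all_smx_cons[pM ps] i [|j]; first by rewrite /= /smx1.
rewrite /= ltnS subSS; case: ifP => js.
  by apply: eq_fsbigr => k _; rewrite IH// js.
rewrite -smx_mulA; [|by case: pM|by case: (lprod_pTN ps)].
by apply: eq_fsbigr => k _; rewrite IH// js.
Qed.

Variable p : nat.
Implicit Type A : 'M[R]_p.

(** The block sum of [A] and an infinite identity: multiplying by it on the right changes only the
    first [p] columns of a staircase. *)
Definition smx_ext A : smx R := fun i j =>
  match insub i, insub j with
  | Some a, Some b => A a b
  | _, _ => (i == j)%:R
  end.

Lemma smx_ext_ord A (a b : 'I_p) : smx_ext A a b = A a b.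
Proof. by rewrite /smx_ext !valK. Qed.

Lemma smx_ext_ge A i j : (p <= i)%N || (p <= j)%N -> smx_ext A i j = (i == j)%:R.
Proof.
rewrite /smx_ext; case: insubP => // a _ <-; case: insubP => // b _ <-.
by rewrite leqNgt ltn_ord leqNgt ltn_ord.
Qed.

Lemma minor_ext r f g A :
  (p <= f r)%N || (p <= g r)%N -> sinc r.+1 f -> sinc r.+1 g ->
  minor r.+1 f g (smx_ext A) = minor r f g (smx_ext A) * (f r == g r)%:R.
Proof.
move=> pfg sf sg; have [gf|fg] := leqP (g r) (f r).
  have pf : (p <= f r)%N by lia.
  rewrite minor_row_last => [|j jr]; first by rewrite smx_ext_ge ?pf.
  by rewrite smx_ext_ge ?pf// gtn_eqF// (leq_trans _ gf)// sg.
have pg : (p <= g r)%N by lia.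
rewrite minor_col_last => [|j jr]; first by rewrite smx_ext_ge ?pg ?orbT.
by rewrite smx_ext_ge ?pg ?orbT// ltn_eqF// (ltn_trans _ fg)// sf.
Qed.

Lemma minor_ext_lt r f g A (F G : 'I_r -> 'I_p) :
  (forall i, F i = f i :> nat) -> (forall i, G i = g i :> nat) ->
  minor r f g (smx_ext A) = \det (mxsub F G A).
Proof.
move=> Ff Gg; congr (\det _); apply/matrixP => i j.
by rewrite !mxE -Ff -Gg smx_ext_ord.
Qed.

Lemma sinc_ord r f : sinc r.+1 f -> (f r < p)%N ->
  exists2 F : 'I_r.+1 -> 'I_p, increasing_ord F & forall i, F i = f i :> nat.
Proof.
move=> sf fr; have H i : (i < r.+1)%N -> (f i < p)%N.
  rewrite ltnS leq_eqVlt => /predU1P[->//|ir].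
  exact: ltn_trans (sf _ _ ir (ltnSn r)) fr.
by exists (fun i : 'I_r.+1 => Ordinal (H i (ltn_ord i))) => // k l kl; exact: sf.
Qed.

Lemma smx_ext_pTN A : upper_unitriangular_TP A -> pTN (smx_ext A).
Proof.
move=> [/is_trig_mxP tA _ pA].
have Et (k l : 'I_p) : (l < k)%N -> A k l = 0 by move=> /tA; rewrite mxE.
split.
- by move=> i; exists (maxn p i.+1) => k ?; rewrite smx_ext_ge; [case: eqP => //; lia|lia].
- by move=> i; exists (maxn p i.+1) => k ?; rewrite /smx_tr smx_ext_ge; [case: eqP => //; lia|lia].
- move=> c r f g sf sg _; elim: r => [|r IH] in f g sf sg *; first by rewrite minor0.
  have [pfg|] := boolP ((p <= f r)%N || (p <= g r)%N).
    by rewrite minor_ext// mulr_ge0// IH//; exact: sinc_lt.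
  rewrite negb_or -!ltnNge => /andP[fp gp].
  have [F iF EF] := sinc_ord sf fp; have [G iG EG] := sinc_ord sg gp.
  rewrite (minor_ext_lt _ EF EG).
  have [H|] := boolP [forall k, (F k <= G k)%N].
    by apply/ltW/pA => // k; exact: (forallP H).
  rewrite negb_forall => /existsP[k]; rewrite -ltnNge => GF.
  (* If [G k < F k], then [G j <= G k < F k <= F i] for [j <= k <= i], so the triangular [A] has a
     zero corner block there. *)
  rewrite (@det_corner0 _ _ _ k)// => i j ki jk; rewrite mxE Et//.
  rewrite EF EG in GF; rewrite EF EG.
  have : (f k <= f i)%N.
    by have [->//|ne] := eqVneq k i; apply/ltnW/sf => //; rewrite ltn_neqAle ne.
  have : (g j <= g k)%N.
    by have [->//|ne] := eqVneq j k; apply/ltnW/sg => //; rewrite ltn_neqAle ne.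
  lia.
- move=> r f sf; elim: r => [|r IH] in f sf *; first by rewrite minor0.
  have [pf|fp] := leqP p (f r).
    by rewrite minor_ext ?pf// eqxx mulr1 IH//; exact: sinc_lt.
  have [F iF EF] := sinc_ord sf fp.
  by rewrite (minor_ext_lt _ EF EF); apply: pA.
Qed.

End Staircase.

(** * Degrees of recursion polynomials *)

Section Degrees.
Variable R : realType.
Implicit Types (M N K : smx R) (f g h : nat -> nat).

Definition upper_tri M := forall i j, (j < i)%N -> M i j = 0.

Definition smx_window (m : nat) M : smx R := fun i j => M (m + i)%N (m + j)%N.

Definition upper_TN M := [/\ rfin M, upper_tri M, forall c, TN c M & up_pos M].

Lemma sinc_addl m r f : sinc r f -> sinc r (fun i => m + f i)%N.
Proof. by move=> sf i j ij jr; rewrite ltn_add2l sf. Qed.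

Lemma upper_TN_window m M : upper_TN M -> upper_TN (smx_window m M).
Proof.
move=> [fM uM tM pM]; split.
- move=> i; have [n H] := fM (m + i)%N; exists n => k nk.
  by apply: H; apply: leq_trans nk (leq_addl _ _).
- by move=> i j ij; apply: uM; rewrite ltn_add2l.
- move=> c r f g sf sg gc.
  apply: (tM (m + c)%N r _ _ (sinc_addl m sf) (sinc_addl m sg)).
  by move=> j /gc; rewrite ltn_add2l.
- move=> r f g sf sg fg.
  apply: (pM r _ _ (sinc_addl m sf) (sinc_addl m sg)).
  by move=> k /fg [->|->]; [left|right; rewrite addnS].
Qed.

Lemma upper_tri_mul M N : rfin M -> upper_tri M -> upper_tri N ->
  upper_tri (smx_mul M N).
Proof.
move=> fM uM uN i j ij; have [n Hn] := fM i.
rewrite (smx_mulE _ _ Hn) big1// => k _.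
have [ki|ik] := ltnP k i; first by rewrite uM ?mul0r.
by rewrite uN ?mulr0// (leq_trans ij).
Qed.

Lemma upper_TN_mul M N : upper_TN M -> upper_TN N -> upper_TN (smx_mul M N).
Proof.
move=> [fM uM tM pM] [fN uN tN pN]; split.
- exact: rfin_mul.
- exact: upper_tri_mul.
- by move=> c; exact: TN_mul.
- move=> r f g sf sg fg; have [c gc] := sinc_bound r g.
  apply: (@minor_mul_gt0 _ c _ _ _ f) => //; last exact: pN.
  by apply: pM => // k _; left.
Qed.

(* By Cramer's rule the entries of the solution are up to sign quotients of
   minors whose column indices are f k or f k + 1. *)
Lemma upper_TN_solution_neq0 N n (y : nat -> R) : up_pos N ->
  (forall c, (c < n)%N -> \sum_(r < n) y r * N r c = (c == 0%N)%:R) ->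
  forall r, (r < n)%N -> y r != 0.
Proof.
case: n => [//|n] pN H r rn.
pose A : 'M[R]_n.+1 := \matrix_(i, j) N i j.
pose Y : 'rV[R]_n.+1 := \row_i y i.
have YA : Y *m A = delta_mx 0 0.
  apply/matrixP => i j; rewrite !mxE ord1 eqxx/=.
  rewrite -(H j (ltn_ord j)); apply: eq_bigr => k _; by rewrite !mxE.
have := congr1 (fun Z => (Z *m \adj A) 0 (Ordinal rn)) YA.
rewrite -mulmxA mul_mx_adj mul_mx_scalar -rowE !mxE => E.
apply/eqP => y0; move/eqP: E; rewrite [y _]y0 mulr0 eq_sym /cofactor mulf_eq0.
rewrite signr_eq0/=; apply/negP/lt0r_neq0.
have -> : \det (row' (Ordinal rn) (col' 0 A)) = minor n (bump r) S N.
  by congr (\det _); apply/matrixP => i j; rewrite !mxE.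
apply: pN.
- by move=> i j ij _; rewrite /bump; lia.
- by move=> i j ij _.
- by move=> k _; rewrite /bump; lia.
Qed.

Variables (p a : nat) (s : R) (K : smx R) (A : nat -> {poly R}).
Hypotheses (ap : (a < p)%N) (gK : upper_TN K).
(** Initial condition and recursion in one triangular system: in the application the first [p]
    columns of [K] are those of [invmx A0] and the later ones those of T + s I, whence the factor
    ['X + s%:P]. *)
Hypothesis AK : forall c, \sum_(m < c.+1) K m c *: A m =
  if (c < p)%N then ((c == a)%:R)%:P else ('X + s%:P) * A (c - p)%N.

Let p0 : (0 < p)%N. Proof. exact: leq_ltn_trans ap. Qed.

Let bound n := if (n < a)%N then 0%N else ((n - a) %/ p).+1.

Let bound_le m n : (m <= n)%N -> (bound m <= bound n)%N.
Proof.
move=> mn; rewrite /bound; case: ifP => [//|]; case: ifP => [|_ _]; first lia.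
by rewrite ltnS leq_div2r// leq_sub2r.
Qed.

Let K_gt0 n : 0 < K n n.
Proof.
have [_ _ _ pK] := gK; have := pK 1%N (fun _ => n) (fun _ => n).
rewrite /minor det_mx11 mxE; apply; try by case=> [|?] [|?].
by left.
Qed.

Let size_A_le n : (size (A n) <= bound n)%N.
Proof.
elim/ltn_ind: n => n IH.
have : K n n *: A n = (if (n < p)%N then ((n == a)%:R)%:P
   else ('X + s%:P) * A (n - p)%N) - \sum_(m < n) K m n *: A m.
  by rewrite -AK big_ord_recr/= addrC addrK.
move=> /(congr1 (fun P : {poly R} => size P)); rewrite (size_scale _ (lt0r_neq0 (K_gt0 n))) => ->.
rewrite (leq_trans (size_polyD _ _))// geq_max size_polyN; apply/andP; split.
  case: ltnP => [np|pn].
    rewrite size_polyC /bound; case: (eqVneq n a) => [->|_]; last by rewrite eqxx.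
    by rewrite ltnn oner_neq0.
  have := IH (n - p)%N; rewrite ltn_subrL p0 (leq_trans p0 pn) => /(_ isT).
  rewrite {1}/bound; case: ltnP => [_|anp H].
    by rewrite leqn0 size_poly_eq0 => /eqP ->; rewrite mulr0 size_poly0.
  rewrite (leq_trans (size_polyMleq _ _))// size_XaddC/=.
  rewrite /bound ltnNge (leq_trans anp (leq_subr _ _))/= ltnS (leq_trans H)//.
  by rewrite subnAC -{2}(subnK (_ : p <= n - a)%N) ?divnDr ?divnn ?p0 ?addn1//; lia.
rewrite (leq_trans (size_sum _ _ _))//; apply/bigmax_leqP => m _.
rewrite (leq_trans (size_scale_leq _ _))// (leq_trans (IH m (ltn_ord m)))//.
by apply: bound_le; exact: ltnW.
Qed.

(** The indices a + d p + r with [r < p] are those where [bound] equals [d.+1], so [y d] lists the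
    candidate leading coefficients of degree [d]. *)
Let y d r := (A (a + d * p + r)%N)`_d.

Let coef_A0 d m : (m < a + d * p)%N -> (A m)`_d = 0.
Proof.
move=> md; apply: nth_default; apply: leq_trans (size_A_le m) _; rewrite /bound.
case: ltnP => // am; rewrite ltn_divLR// ltn_subLR//; lia.
Qed.

(** Comparison of the coefficients of degree [d] in [AK]. Polynomials before the window have smaller
    degree, and on the right only the factor ['X] reaches degree [d], as [s] multiplies a polynomial
    of degree below [d]. *)
Let y_window d c : (c < p)%N ->
  \sum_(r < p) y d r * smx_window (a + d * p) K r c =
  if d is d'.+1 then y d' c else (c == 0%N)%:R.
Proof.
move=> cp; have := congr1 (fun P : {poly R} => P`_d) (AK (a + d * p + c)).
rewrite coef_sum => E.
have -> : \sum_(r < p) y d r * smx_window (a + d * p) K r c =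
    \sum_(m < (a + d * p + c).+1) (K m (a + d * p + c)%N *: A m)`_d.
  pose F m := (K m (a + d * p + c)%N *: A m)`_d.
  rewrite -(big_mkord xpredT F) (@big_cat_nat _ _ _ (a + d * p)%N)//=; last lia.
  have -> : \sum_(0 <= m < a + d * p) F m = 0.
    by rewrite big_nat big1 // => m /andP[_ mad]; rewrite /F coefZ coef_A0 ?mulr0.
  rewrite add0r -{2}[(a + d * p)%N]add0n big_addn -addnS addKn.
  rewrite (big_mkord xpredT (fun i => F (i + (a + d * p))%N)).
  rewrite (big_ord_widen p (fun i => F (i + (a + d * p))%N) cp) [RHS]big_mkcond.
  apply: eq_bigr => i _; rewrite ltnS; case: leqP => [_|ci].
    by rewrite /F coefZ mulrC /y /smx_window addnC.
  by have [_ uK _ _] := gK; rewrite /smx_window uK ?mulr0// ltn_add2l.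
rewrite E; case: d {E} => [|d].
  rewrite mul0n addn0; case: ltnP => [acp|pac].
    by rewrite coefC eqxx -[X in _ == X]addn0 eqn_add2l.
  rewrite coef0M (@coef_A0 0) ?mulr0 ?mul0n ?addn0; last lia.
  by case: eqP => //; lia.
rewrite ifN; last by rewrite -leqNgt mulSn; lia.
have -> : (a + d.+1 * p + c - p = a + d * p + c)%N by rewrite mulSn; lia.
by rewrite mulrDl coefD coefXM/= coefCM coef_A0 ?mulr0 ?addr0// mulSn; lia.
Qed.

Let winprod := fix winprod d := if d is d'.+1
  then smx_mul (smx_window (a + d * p) K) (winprod d') else smx_window a K.

Let winprod_upper_TN d : upper_TN (winprod d).
Proof.
elim: d => [|d IH]; first exact: upper_TN_window.
by apply: upper_TN_mul => //; exact: upper_TN_window.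
Qed.

(** Each window matrix sends [y d.+1] to [y d], down to [e_0]. Cutting the products to size [p]
    loses nothing because the windows are upper triangular. *)
Let y_winprod d c : (c < p)%N -> \sum_(r < p) y d r * winprod d r c = (c == 0%N)%:R.
Proof.
elim: d => [|d IH] cp; first by rewrite -(y_window 0 cp) mul0n addn0.
rewrite -(IH cp).
transitivity (\sum_(r < p) \sum_(k < p)
    y d.+1 r * smx_window (a + d.+1 * p) K r k * winprod d k c).
  apply: eq_bigr => r _; rewrite /= /smx_mul (@fsum_ord _ _ p) ?mulr_sumr.
    by apply: eq_bigr => k _; rewrite mulrA.
  move=> k pk; have [_ u _ _] := winprod_upper_TN d.
  by rewrite u ?mulr0// (leq_trans cp).
rewrite exchange_big; apply: eq_bigr => k _ /=.
by rewrite -mulr_suml (y_window d.+1 (ltn_ord k)).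
Qed.

Lemma size_left_poly n : size (A n) = bound n.
Proof.
apply/eqP; rewrite eqn_leq size_A_le /bound/=; case: ltnP => // an.
have [d [r [rp nE]]] : exists d r, (r < p)%N /\ n = (a + d * p + r)%N.
  exists ((n - a) %/ p)%N, ((n - a) %% p)%N; rewrite ltn_mod p0; split => //.
  by rewrite -addnA -divn_eq subnKC.
have -> : ((n - a) %/ p = d)%N.
  by rewrite nE -addnA addKn divnMDl// divn_small ?addn0.
have yr : y d r != 0.
  have [_ _ _ u] := winprod_upper_TN d.
  exact: (upper_TN_solution_neq0 u (@y_winprod d) rp).
by rewrite ltnNge; apply: contra yr => H; rewrite /y -nE nth_default.
Qed.

End Degrees.

(** For the label [a.+1] the numerator is n + 1 - a. If [n < a] it lies between -p, excluded, and 0,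
    so the ceiling is 0 and the degree is -1. *)
Lemma step_degreeE (n a p : nat) : (a < p)%N ->
  (if (n < a)%N then 0%N else ((n - a) %/ p).+1)%:Z - 1 = step_degree n a.+1 p.
Proof.
move=> ap; rewrite /step_degree; congr (_ - 1); apply/esym/ceil_def.
have p0 : (0 : rat) < p%:R by rewrite ltr0n (leq_ltn_trans _ ap).
rewrite ltr_pdivlMr// ler_pdivrMr// pmulrn -!intrM ltr_int ler_int.
case: ltnP => na; first by apply/andP; split; lia.
have := divn_eq (n - a) p; have := ltn_pmod (n - a) (leq_ltn_trans (leq0n a) ap).
move: (_ %/ _)%N (_ %% _)%N => d r rp E.
by apply/andP; split; nia.
Qed.

(** * From the bidiagonal factorization to the matrix K, the degrees and the transposed data *)

Section LeftData.
Variable R : realType.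
Implicit Types (M N K T S W : smx R).

Lemma upper_tri1 : upper_tri (@smx1 R).
Proof. by move=> i j ji; rewrite /smx1 gtn_eqF. Qed.

Lemma upper_tri_lprod (s : seq (smx R)) :
  all_smx (@pTN R) s -> all_smx (@upper_tri R) s -> upper_tri (lprod s).
Proof.
elim: s => [|M s IH]; first by move=> _ _; exact: upper_tri1.
move=> /all_smx_cons[pM ps] /all_smx_cons[uM us] /=.
by apply: upper_tri_mul => //; [case: pM | exact: IH].
Qed.

Lemma upper_tri_stair (s : seq (smx R)) W :
  all_smx (@pos_lower_bd R) s -> upper_tri W -> upper_tri (stair s W).
Proof.
elim: s => [//|M s IH] /all_smx_cons[bM bs] uW [//|i] [|j] ij.
  by [].
have [fM _ _ _] := pos_lower_bd_pTN bM; have [n Hn] := fM i.+1.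
rewrite /= (smx_mulE _ _ Hn) big1// => k _.
have [ik|ki] := ltnP k i; last by rewrite (IH bs uW) ?mulr0// (leq_trans _ ki).
by have [[_ _ z] _] := bM; rewrite z ?mul0r//; lia.
Qed.

Lemma upper_tri_ext p (A : 'M[R]_p) : upper_triangular A -> upper_tri (smx_ext A).
Proof.
move=> /is_trig_mxP tA i j ji.
have [pij|] := boolP ((p <= i)%N || (p <= j)%N).
  by rewrite smx_ext_ge// gtn_eqF.
rewrite negb_or -!ltnNge => /andP[ip jp].
rewrite (smx_ext_ord A (Ordinal ip) (Ordinal jp)).
by have := tA (Ordinal jp) (Ordinal ip) ji; rewrite mxE.
Qed.

(* [Lam] stores the first columns of the partial products, as in [Lambda_mx];
   applied to the transposed matrix it also covers [Upsilon_mx]. *)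
Definition left_data p S (Ls : seq (smx R)) W (Lam : 'M[R]_p) :=
  [/\ size Ls = p, all_smx (@pos_lower_bd R) Ls, pTN W /\ upper_tri W,
      S = smx_mul (lprod Ls) W &
      forall i j : 'I_p, Lam i j = lprod (take j Ls) i 0%N].

Lemma all_smx_take P (s : seq (smx R)) n : all_smx P s -> all_smx P (take n s).
Proof. by rewrite -{1}(cat_take_drop n s) => /all_smx_catP[]. Qed.

Lemma all_smx_drop P (s : seq (smx R)) n : all_smx P s -> all_smx P (drop n s).
Proof. by rewrite -{1}(cat_take_drop n s) => /all_smx_catP[]. Qed.

Lemma all_smx_imp (P Q : smx R -> Prop) (s : seq (smx R)) :
  (forall M, P M -> Q M) -> all_smx P s -> all_smx Q s.
Proof. by move=> PQ H i si; apply/PQ/H. Qed.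

Lemma lprod_col0 (s : seq (smx R)) i : all_smx (@pos_lower_bd R) s ->
  (size s < i)%N -> lprod s i 0%N = 0.
Proof.
elim: s i => [|M s IH] [//|i] ; first by rewrite /= /smx1.
move=> /all_smx_cons[bM bs] /= si.
have [fM _ _ _] := pos_lower_bd_pTN bM; have [n Hn] := fM i.+1.
rewrite (smx_mulE _ _ Hn) big1// => k _.
have [ki|ik] := ltnP k i; last by rewrite (IH _ bs) ?mulr0// (leq_trans _ ik).
by have [[_ _ z] _] := bM; rewrite z ?mul0r//; lia.
Qed.

Section Package.
Variables (p : nat) (S : smx R) (Ls : seq (smx R)) (W : smx R).
Variables (Lam A : 'M[R]_p).
Hypotheses (p0 : (0 < p)%N) (dS : left_data S Ls W Lam).
Hypothesis tA : upper_unitriangular_TP A.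

(** The matrix K of the overview: [stair_mx_left] and [stair_mx_right] identify its columns. *)
Definition stair_mx : smx R := smx_mul (stair Ls W) (smx_ext A).

Lemma stair_mx_upper_TN : upper_TN stair_mx.
Proof.
have [sz bL [pW uW] _ _] := dS.
have pZ := stair_pTN bL pW; have [fZ _ tZ dZ] := pZ.
have pE := smx_ext_pTN tA; have [fE _ tE dE] := pE.
have [tri _ _] := tA.
split.
- exact: rfin_mul.
- apply: upper_tri_mul => //; first exact: upper_tri_stair.
  exact: upper_tri_ext.
- by move=> c; exact: TN_mul.
- move=> r f g sf sg fg; have [c gc] := sinc_bound r g.
  apply: (@minor_mul_gt0 _ c _ _ _ g) => //; last exact: dE.
  by apply: (stair_up_pos bL) => //; rewrite sz.
Qed.

Lemma stair_mx_sum (i : nat) (c : 'I_p) :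
  stair_mx i c = \sum_(k < p) A k c * lprod (take k Ls) i 0%N.
Proof.
have [sz bL [pW uW] _ EL] := dS.
have pL : all_smx (@pTN R) Ls by apply: all_smx_imp bL; exact: pos_lower_bd_pTN.
rewrite /stair_mx /smx_mul (@fsum_ord _ _ p) => [|k pk].
  by apply: eq_bigr => k _; rewrite smx_ext_ord stairE// sz ltn_ord mulrC.
by rewrite smx_ext_ge ?pk// gtn_eqF ?mulr0// (leq_trans (ltn_ord c)).
Qed.

(** At most [p - 1] bidiagonal factors occur, so the finite matrix Lambda records these columns
    completely. *)
Lemma lprod_take_col0 (k : 'I_p) i : (p <= i)%N -> lprod (take k Ls) i 0%N = 0.
Proof.
have [sz bL _ _ _] := dS => pi; rewrite lprod_col0//; first exact: all_smx_take.
by rewrite size_take sz ltn_ord (leq_trans (ltn_ord k)).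
Qed.

Lemma stair_mx_left (i : nat) (c : 'I_p) :
  stair_mx i c = if insub i is Some a then (Lam *m A) a c else 0.
Proof.
have [_ _ _ _ EL] := dS; rewrite stair_mx_sum.
case: insubP => [a _ <-|pi].
  by rewrite mxE; apply: eq_bigr => k _; rewrite EL mulrC.
by apply: big1 => k _; rewrite lprod_take_col0 ?mulr0// leqNgt.
Qed.

Lemma stair_mx_right i c : (p <= c)%N -> stair_mx i c = S i (c - p)%N.
Proof.
have [sz bL [pW uW] ES _] := dS => pc.
have pL : all_smx (@pTN R) Ls by apply: all_smx_imp bL; exact: pos_lower_bd_pTN.
rewrite /stair_mx /smx_mul (@fsum_ord _ _ c.+1) => [|k pk].
  rewrite big_ord_recr/= big1 ?add0r => [|k _].
    by rewrite smx_ext_ge ?pc ?orbT// eqxx mulr1 stairE// sz ltnNge pc/= ES.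
  by rewrite smx_ext_ge ?pc ?orbT// ltn_eqF ?mulr0.
by rewrite smx_ext_ge ?pc ?orbT// gtn_eqF ?mulr0.
Qed.

(** This entry of [S] is a diagonal entry of [stair_mx]. It is the coefficient by which the
    recursion is later divided. *)
Lemma left_data_gt0 n : 0 < S (n + p)%N n.
Proof.
have := @stair_mx_right (n + p)%N (n + p)%N (leq_addl _ _); rewrite addnK => <-.
have [_ _ _ pK] := stair_mx_upper_TN; have := pK 1%N (fun _ => n + p)%N (fun _ => n + p)%N.
rewrite /minor det_mx11 mxE; apply; try by case=> [|?] [|?].
by left.
Qed.

Lemma left_degrees T s (A0 : 'M[R]_p) (P : 'I_p -> nat -> {poly R}) :
  S = smx_shift T s -> (forall i j, (j + p < i)%N -> T i j = 0) ->
  left_recursion_polys T A0 P -> invmx A0 = Lam *m A ->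
  forall n a, degz (P a n) = step_degree n a.+1 p.
Proof.
move=> ES bT [_ uA0 P0 PT] EA n a.
have [fK uK _ _] := stair_mx_upper_TN.
rewrite -(step_degreeE n (ltn_ord a)) /degz; congr (_%:Z - 1).
apply: (size_left_poly (s := s) (ltn_ord a) stair_mx_upper_TN) => c.
case: ltnP => cp; last first.
  pose d := (c - p)%N; have Ec : c = (d + p)%N by rewrite subnK.
  have := PT a d; rewrite (@fsum_ord _ _ c.+1) => [E|m cm]; last first.
    by rewrite bT ?scale0r// -Ec.
  rewrite mulrDl -E mul_polyC.
  have dc : (d < c.+1)%N by rewrite ltnS leq_subr.
  (* Only the diagonal term [m = d] distinguishes [S] from [T]; it supplies the summand
     [s *: P a d]. *)
  rewrite [X in _ = X + _](bigD1 (Ordinal dc))//= [LHS](bigD1 (Ordinal dc))//=.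
  rewrite stair_mx_right// ES /smx_shift /smx1 eqxx mulr1 scalerDl.
  rewrite -!addrA; congr (_ + _); rewrite addrC; congr (_ + _).
  apply: eq_bigr => m /negP md; rewrite stair_mx_right// ES /smx_shift /smx1.
  have -> : (m == c - p :> nat)%N = false.
    by apply/negP => /eqP md'; apply/md/eqP/val_inj.
  by rewrite mulr0 addr0.
transitivity (\sum_(m < p) stair_mx m c *: P a m).
  rewrite (big_ord_widen p (fun m => stair_mx m c *: P a m) cp) big_mkcond.
  by apply: eq_bigr => m _; rewrite ltnS; case: leqP => // cm; rewrite uK ?scale0r.
transitivity (((A0 *m invmx A0) a (Ordinal cp))%:P).
  rewrite mxE rmorph_sum; apply: eq_bigr => m _ /=.
  rewrite (stair_mx_left m (Ordinal cp)) valK -EA P0.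
  by rewrite -mul_polyC -polyCM mulrC.
by rewrite mulmxV// mxE eq_sym.
Qed.

End Package.

Lemma big_lprod (F : nat -> smx R) (s : seq nat) :
  \big[@smx_mul R/smx1 R]_(k <- s) F k = lprod (map F s).
Proof. by elim: s => [|k s IH]; rewrite ?big_nil// big_cons IH. Qed.

Lemma pos_lower_bidiagonalP M : pos_lower_bidiagonal M -> pos_lower_bd M.
Proof.
move=> [d s z]; split => //; split => // i; first by rewrite d.
exact/ltW/s.
Qed.

Lemma pos_upper_bidiagonalP M : pos_upper_bidiagonal M -> pos_lower_bd (smx_tr M).
Proof.
move=> [d s z]; split => //; split.
- by move=> i; rewrite /smx_tr d.
- by move=> i; exact/ltW/s.
- by move=> i j ji ij; rewrite /smx_tr z// eq_sym.
Qed.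

Lemma pos_diagonalP M : pos_diagonal M -> lower_bidiag M.
Proof.
move=> [d z]; split => // [i|i j ji _]; last by rewrite z// eq_sym.
by rewrite z// gtn_eqF.
Qed.

Lemma PBF_left_data p q S L D U : is_PBF p q S L D U ->
  left_data S (map L (iota 1 p)) (smx_mul D (Uprod U q)) (Lambda_mx p L).
Proof.
move=> [pL pD pU ES].
have bL : all_smx (@pos_lower_bd R) (map L (iota 1 p)).
  move=> i; rewrite size_map size_iota => ip.
  rewrite (nth_map 0%N) ?size_iota// nth_iota//.
  by apply/pos_lower_bidiagonalP/pL; lia.
have bU : all_smx (fun M => pos_lower_bd (smx_tr M)) (map U (rev (iota 1 q))).
  move=> i; rewrite size_map size_rev size_iota => iq.
  rewrite (nth_map 0%N) ?size_rev ?size_iota// nth_rev ?size_iota// nth_iota; last lia.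
  by apply/pos_upper_bidiagonalP/pU; lia.
have tU : all_smx (@pTN R) (map U (rev (iota 1 q))).
  by apply: all_smx_imp bU => M /pos_lower_bd_pTN/pTN_tr.
have pDD := bidiag_pTN (pos_diagonalP pD).
have EU : Uprod U q = lprod (map U (rev (iota 1 q))).
  by rewrite /Uprod big_lprod /index_iota subn1.
have EL j : Lprod L j = lprod (map L (iota 1 j)).
  by rewrite /Lprod big_lprod /index_iota subn1.
split => //.
- by rewrite size_map size_iota.
- split; first by apply: pTN_mul => //; rewrite EU; exact: lprod_pTN.
  apply: upper_tri_mul; first by case: pDD.
    by move=> i j ji; have [_ z] := pD; rewrite z// gtn_eqF.
  rewrite EU; apply: upper_tri_lprod => //; apply: all_smx_imp bU => M [[_ _ z] _] i j ji.
  by apply: (z j i); lia.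
- rewrite ES EL smx_mulA//; last by case: pDD.
  by have [] := lprod_pTN (all_smx_imp (@pos_lower_bd_pTN R) bL).
- by move=> i j; rewrite mxE EL -map_take take_iota (minn_idPl (ltnW (ltn_ord j))).
Qed.

Lemma PBF_pTN_L p q S L D U : is_PBF p q S L D U ->
  all_smx (@pTN R) (map L (iota 1 p)).
Proof.
move=> [pL _ _ _] i; rewrite size_map size_iota => ip.
rewrite (nth_map 0%N) ?size_iota// nth_iota//.
by apply/pos_lower_bd_pTN/pos_lower_bidiagonalP/pL; lia.
Qed.

Lemma PBF_pTN_U p q S L D U : is_PBF p q S L D U ->
  all_smx (@pTN R) (map U (rev (iota 1 q))).
Proof.
move=> [_ _ pU _] i; rewrite size_map size_rev size_iota => iq.
rewrite (nth_map 0%N) ?size_rev ?size_iota// nth_rev ?size_iota// nth_iota; last lia.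
rewrite -(smx_trK (U _)).
by apply/pTN_tr/pos_lower_bd_pTN/pos_upper_bidiagonalP/pU; lia.
Qed.

Lemma PBF_le p q S L D U j : (j <= q)%N -> is_PBF p q S L D U ->
  exists S', is_PBF p j S' L D U.
Proof.
move=> jq [pL pD pU _].
exists (smx_mul (smx_mul (Lprod L p) D) (Uprod U j)); split => // i /andP[i1 ij].
by apply: pU; rewrite i1 (leq_trans ij).
Qed.

Lemma Lprod_tr p q S L D U j : is_PBF p q S L D U -> (j <= q)%N ->
  Lprod (fun i => smx_tr (U i)) j = smx_tr (Uprod U j).
Proof.
move=> + jq => /(PBF_le jq)[S' /PBF_pTN_U pU].
rewrite /Uprod /Lprod !big_lprod /index_iota !subn1 lprod_tr//; congr lprod.
by rewrite !map_rev revK -map_comp.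
Qed.

Lemma Uprod_tr p q S L D U : is_PBF p q S L D U ->
  Uprod (fun i => smx_tr (L i)) p = smx_tr (Lprod L p).
Proof.
move=> /PBF_pTN_L pL.
rewrite /Uprod /Lprod !big_lprod /index_iota !subn1 lprod_tr//; congr lprod.
by rewrite !map_rev -map_comp.
Qed.

(** Transposition reverses the product and exchanges the two families of factors, so the facts about
    the left data also apply to the right data. *)
Lemma PBF_tr p q S L D U : is_PBF p q S L D U ->
  is_PBF q p (smx_tr S) (fun i => smx_tr (U i)) (smx_tr D) (fun i => smx_tr (L i)).
Proof.
move=> H; have [pL pD pU ES] := H; split.
- move=> i /pU [d s z]; split => // a b ba ab.
  by rewrite /smx_tr z// eq_sym.
- by have [d z] := pD; split => // i j ij; rewrite /smx_tr z// eq_sym.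
- move=> i /pL [d s z]; split => // a b ba ab.
  by rewrite /smx_tr z// eq_sym.
- rewrite (Uprod_tr H) (Lprod_tr H)// ES !smx_tr_mul smx_mulA//.
    rewrite /Uprod big_lprod /index_iota subn1.
    by have [] := pTN_tr (lprod_pTN (PBF_pTN_U H)).
  by case: (pTN_tr (bidiag_pTN (pos_diagonalP pD))).
Qed.

Lemma Upsilon_tr p q S L D U : is_PBF p q S L D U ->
  (Upsilon_mx q U)^T = Lambda_mx q (fun i => smx_tr (U i)).
Proof.
move=> H; apply/matrixP => i j.
by rewrite !mxE (Lprod_tr H)// ltnW.
Qed.

End LeftData.

(** * Positivity of Hankel forms *)

Section Hankel.
Variable R : realType.
Implicit Types (M N H S V : smx R) (f g h : nat -> nat).

Lemma minor2 f g M : minor 2 f g M =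
  M (f 0%N) (g 0%N) * M (f 1%N) (g 1%N) - M (f 0%N) (g 1%N) * M (f 1%N) (g 0%N).
Proof.
rewrite /minor (expand_det_row _ ord0) !big_ord_recl big_ord0 /cofactor !det_mx11.
by rewrite !mxE /= /bump /=; ring.
Qed.

(** Row elimination by the unitriangular [E]. Up to the pivot, principal minors of the Schur
    complement are principal minors of [H], so the hypothesis of [psd_of_minors] is inherited. *)
Lemma minor_schur r f H : H 0%N 0%N != 0 ->
  minor r.+1 (fun i => if i is i'.+1 then (f i').+1 else 0%N)
             (fun i => if i is i'.+1 then (f i').+1 else 0%N) H =
  H 0%N 0%N * minor r f f
    (fun i j => H i.+1 j.+1 - H i.+1 0%N * H 0%N j.+1 / H 0%N 0%N).
Proof.
move=> h0; set g := fun i => _.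
pose N : smx R := fun i j =>
  if i is _.+1 then H i j - H i 0%N * H 0%N j / H 0%N 0%N else H 0%N j.
pose E : 'M[R]_r.+1 := \matrix_(i, j)
  ((i == j)%:R + ((i != 0) && (j == 0))%:R * (H (g i) 0%N / H 0%N 0%N)).
have -> : minor r.+1 g g H = \det E * minor r.+1 g g N.
  rewrite /minor -det_mulmx; congr (\det _); apply/matrixP => i j; rewrite !mxE.
  transitivity (N (g i) (g j) + (i != 0)%:R * (H (g i) 0%N / H 0%N 0%N * N 0%N (g j))).
    case: i => -[|i] ir /=; first by rewrite mul0r addr0.
    by rewrite mul1r; field.
  transitivity (\sum_(k < r.+1) ((i == k)%:R * N (g k) (g j) +
     ((i != 0) && (k == 0))%:R * (H (g i) 0%N / H 0%N 0%N * N (g k) (g j)))).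
    rewrite big_split /= (bigD1 i)//= eqxx mul1r big1 ?addr0 => [|k /negPf ki].
      rewrite (bigD1 ord0)//= eqxx andbT big1 ?addr0// => k /negPf ->.
      by rewrite andbF mul0r.
    by rewrite eq_sym ki mul0r.
  by apply: eq_bigr => k _; rewrite !mxE mulrDl !mulrA.
have -> : \det E = 1.
  rewrite det_trig => [|].
    apply: big1 => i _; rewrite mxE eqxx; case: eqVneq => _ /=; rewrite ?mul0r ?addr0//.
  apply/is_trig_mxP => i j ij; rewrite mxE.
  have -> : (i == j) = false by apply/negP => /eqP ji; move: ij; rewrite ji ltnn.
  have -> : (j == 0) = false by apply/negP => /eqP ji; move: ij; rewrite ji ltn0.
  by rewrite andbF mul0r addr0.
rewrite mul1r minor_col0 => [|[|i] _ //=].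
  by congr (_ * _); apply: eq_minor.
by rewrite mulfK ?subrr.
Qed.

(** Induction on [n], completing the square at a positive pivot. At a zero pivot the principal
    minors of order 2 force the first row to vanish, which leading minors alone would not do. *)
Lemma psd_of_minors H : (forall i j, H i j = H j i) ->
  (forall r f, sinc r f -> 0 <= minor r f f H) ->
  forall n (x : nat -> R), 0 <= \sum_(i < n) \sum_(j < n) x i * x j * H i j.
Proof.
move=> + + n; elim: n H => [|n IH] H symH pH x; first by rewrite big_ord0.
have h0 : 0 <= H 0%N 0%N.
  by have := pH 1%N (fun=> 0%N); rewrite /minor det_mx11 mxE; apply => -[|?] [].
pose sg := \sum_(j < n) x j.+1 * H 0%N j.+1.
have -> : \sum_(i < n.+1) \sum_(j < n.+1) x i * x j * H i j =
   H 0%N 0%N * x 0%N ^+ 2 + 2 * x 0%N * sg +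
   \sum_(i < n) \sum_(j < n) x i.+1 * x j.+1 * H i.+1 j.+1.
  have E (F : nat -> nat -> R) : \sum_(i < n.+1) \sum_(j < n.+1) F i j =
      F 0%N 0%N + \sum_(j < n) F 0%N j.+1 +
      (\sum_(i < n) F i.+1 0%N + \sum_(i < n) \sum_(j < n) F i.+1 j.+1).
    rewrite big_ord_recl big_ord_recl -big_split; congr (_ + _).
    by apply: eq_bigr => i _; rewrite big_ord_recl.
  rewrite (E (fun i j => x i * x j * H i j)).
  have -> : \sum_(i < n) x 0%N * x i.+1 * H 0%N i.+1 = x 0%N * sg.
    by rewrite mulr_sumr; apply: eq_bigr => i _; rewrite mulrA.
  have -> : \sum_(i < n) x i.+1 * x 0%N * H i.+1 0%N = x 0%N * sg.
    by rewrite mulr_sumr; apply: eq_bigr => i _; rewrite symH; ring.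
  by ring.
have [h00|h00] := eqVneq (H 0%N 0%N) 0.
  have H0 j : H 0%N j = 0.
    case: j => [//|j].
    have := pH 2%N (fun i => if i is 0%N then 0%N else j.+1).
    rewrite minor2 h00 mul0r sub0r (symH j.+1) -expr2.
    move=> /(_ _) H2; apply/eqP; rewrite -sqrf_eq0 eq_le sqr_ge0 andbT -oppr_ge0.
    by apply: H2 => -[|[|?]] [|[|?]].
  have -> : sg = 0 by rewrite /sg big1// => j _; rewrite H0 mulr0.
  rewrite h00 mul0r mulr0 !add0r.
  apply: (IH (fun i j => H i.+1 j.+1)) (fun i => x i.+1) => // r f sf.
  by apply: (pH r (fun i => (f i).+1)) => i j ij jr; rewrite ltnS sf.
have hp : 0 < H 0%N 0%N by rewrite lt_neqAle eq_sym h00.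
pose H' := fun i j => H i.+1 j.+1 - H i.+1 0%N * H 0%N j.+1 / H 0%N 0%N.
have := IH H' _ _ (fun i => x i.+1).
have -> : \sum_(i < n) \sum_(j < n) x i.+1 * x j.+1 * H' i j =
   \sum_(i < n) \sum_(j < n) x i.+1 * x j.+1 * H i.+1 j.+1 - sg ^+ 2 / H 0%N 0%N.
  rewrite expr2 {1}/sg !mulr_suml -sumrB; apply: eq_bigr => i _.
  rewrite -mulrA mulr_suml mulr_sumr -sumrB; apply: eq_bigr => j _.
  by rewrite /H' (symH i.+1 0%N); ring.
move=> /(_ _ _)/[dup] K.
have -> : H 0%N 0%N * x 0%N ^+ 2 + 2 * x 0%N * sg =
   H 0%N 0%N * (x 0%N + sg / H 0%N 0%N) ^+ 2 - sg ^+ 2 / H 0%N 0%N by field.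
rewrite -addrA => _; apply: addr_ge0; first by rewrite mulr_ge0// sqr_ge0.
rewrite addrC; apply: K.
  by move=> i j; rewrite /H' symH (symH i.+1 0%N) (symH 0%N j.+1); ring.
move=> r f sf; rewrite -(pmulr_rge0 _ hp) -minor_schur//; apply: pH.
by move=> [|i] [|j]//= ij jr; rewrite ltnS sf.
Qed.

Definition fsupp (x : nat -> R) := exists n, forall k, (n <= k)%N -> x k = 0.

Lemma fsupp_app M x : rfin (smx_tr M) -> fsupp x -> fsupp (smx_app M x).
Proof.
move=> fM [n xn]; have [m Hm] := rfin_unif n id fM; exists m => k mk.
rewrite /smx_app (@fsum_ord _ _ n) => [|l nl]; last by rewrite xn ?mulr0.
by apply: big1 => l _; rewrite [M k l](Hm l (ltn_ord l) k mk) mul0r.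
Qed.

Lemma smx_app_dot M x y : rfin M -> fsupp x ->
  \sum_(k \in [set: nat]) smx_app (smx_tr M) x k * y k =
  \sum_(k \in [set: nat]) x k * smx_app M y k.
Proof.
move=> fM [n xn].
(* Associativity, with [x] seen as a matrix of equal rows and [y] as one of equal columns. *)
have := @smx_mulA _ (fun _ k => x k) M (fun k _ => y k) _ fM.
move=> /(_ (fun _ => ex_intro _ n xn))/(congr1 (fun A => A 0%N 0%N)) E.
rewrite -[RHS]/(smx_mul (fun _ k => x k) (smx_mul M (fun k _ => y k)) 0%N 0%N) E.
apply: eq_fsbigr => k _; congr (_ * _); apply: eq_fsbigr => l _.
by rewrite mulrC.
Qed.

Lemma smx_app_dot_iter M x y n : rfin M -> rfin (smx_tr M) -> fsupp x ->
  \sum_(k \in [set: nat]) iter n (smx_app (smx_tr M)) x k * y k =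
  \sum_(k \in [set: nat]) x k * iter n (smx_app M) y k.
Proof.
move=> fM fMt; elim: n x y => [//|n IH] x y sx.
rewrite iterSr IH; last exact: fsupp_app.
exact: smx_app_dot.
Qed.

Definition krylov S (v : nat -> R) : smx R := fun k m => iter m (smx_app S) v k.

Lemma krylov_TN S V V' v : pTN V -> pTN V' -> S = smx_mul V V' ->
  (forall k, v k = V k 0%N) -> forall c, TN c (krylov S v).
Proof.
move=> [fV _ tV _] [fV' _ tV' _] ES Ev.
apply: (TN_krylov fV fV' tV tV'); apply/funext => k; apply/funext => -[|m].
  by rewrite -[RHS]/(smx_mul V (@smx1 R) k 0%N) smx_mul1r /krylov/= Ev.
rewrite -[RHS]/(smx_mul V (smx_mul V' (krylov S v)) k m) smx_mulA// -ES.
by [].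
Qed.

(** Entry [(i, j)] pairs the [i]-th iterate of [w] under the transpose of [S] with the [j]-th
    iterate of [v] under [S], so the Hankel matrix is a product of two Krylov matrices. The two
    factorizations are independent: [v] and [w] may come from different partial products. *)
Lemma hankel_psd S V V' U U' v w n (x : nat -> R) :
  pTN V -> pTN V' -> S = smx_mul V V' -> (forall k, v k = V k 0%N) ->
  pTN U -> pTN U' -> smx_tr S = smx_mul U U' -> (forall k, w k = U k 0%N) ->
  0 <= \sum_(i < n) \sum_(j < n) x i * x j *
        \sum_(k \in [set: nat]) w k * iter (i + j) (smx_app S) v k.
Proof.
move=> pV pV' ES Ev pU pU' ES' Ew.
have [fS fSt _ _] : pTN S by rewrite ES; exact: pTN_mul.
have fw : fsupp w.
  by have [_ fU _ _] := pU; have [m Hm] := fU 0%N; exists m => k /Hm; rewrite Ew.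
pose Rm := smx_tr (krylov (smx_tr S) w).
pose C := krylov S v.
have tC := krylov_TN pV pV' ES Ev.
have tR c : TN c Rm.
  move=> r f g sf sg _; rewrite minor_tr; have [d fd] := sinc_bound r f.
  exact: (krylov_TN pU pU' ES' Ew (c := d)).
have fR : rfin Rm.
  elim => [//|i IH]; rewrite /Rm /krylov /smx_tr /=.
  exact: fsupp_app.
pose H i j := \sum_(k \in [set: nat]) w k * iter (i + j) (smx_app S) v k.
have EH : H = smx_mul Rm C.
  apply/funext => i; apply/funext => j.
  by rewrite /smx_mul /Rm /smx_tr /krylov smx_app_dot_iter// /H iterD.
apply: (@psd_of_minors H); first by move=> i j; rewrite /H addnC.
move=> r f sf; rewrite EH; have [c fc] := sinc_bound r f.
exact: (TN_mul fR tR (tC c)).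
Qed.

End Hankel.

(** * Algebraic biorthogonality *)

Section Papp.
Variable R : realType.
Implicit Types (M S T : smx R) (P Q : {poly R}) (v u x y : nat -> R).

Definition papp M P v : nat -> R :=
  fun k => \sum_(i < size P) P`_i * iter i (smx_app M) v k.

Lemma pappE M P v k n : (size P <= n)%N ->
  papp M P v k = \sum_(i < n) P`_i * iter i (smx_app M) v k.
Proof.
move=> Pn; rewrite /papp (big_ord_widen n (fun i => P`_i * iter i (smx_app M) v k) Pn).
rewrite big_mkcond; apply: eq_bigr => i _; case: ltnP => // Pi.
by rewrite nth_default ?mul0r.
Qed.

Lemma papp_lin M a P Q v k :
  papp M (a *: P + Q) v k = a * papp M P v k + papp M Q v k.
Proof.
pose n := maxn (size (a *: P + Q)) (maxn (size P) (size Q)).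
rewrite !(@pappE _ _ _ _ n) ?leq_max ?leqnn ?orbT// mulr_sumr -big_split.
by apply: eq_bigr => i _; rewrite coefD coefZ mulrDl mulrA.
Qed.

Lemma pappC M c v k : papp M c%:P v k = c * v k.
Proof. by rewrite (@pappE _ _ _ _ 1) ?size_polyC_leq1// big_ord1 coefC. Qed.

Lemma papp0 M v k : papp M 0 v k = 0.
Proof. by rewrite /papp size_poly0 big_ord0. Qed.

Lemma pappD M P Q v k : papp M (P + Q) v k = papp M P v k + papp M Q v k.
Proof. by rewrite -[P]scale1r papp_lin mul1r scale1r. Qed.

Lemma pappZ M a P v k : papp M (a *: P) v k = a * papp M P v k.
Proof. by rewrite -[a *: P]addr0 papp_lin papp0 addr0. Qed.

Lemma papp_sum M (I : Type) (r : seq I) (F : I -> {poly R}) v k :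
  papp M (\sum_(i <- r) F i) v k = \sum_(i <- r) papp M (F i) v k.
Proof.
elim: r => [|i r IH]; first by rewrite !big_nil papp0.
by rewrite !big_cons pappD IH.
Qed.

Lemma papp_mulX M P v k : papp M (P * 'X) v k = papp M P (smx_app M v) k.
Proof.
have sz : (size (P * 'X)%R <= (size P).+1)%N.
  by rewrite (leq_trans (size_polyMleq _ _))// size_polyX addn2.
rewrite (pappE _ _ _ sz) big_ord_recl coefMX mul0r add0r.
by apply: eq_bigr => i _; rewrite coefMX /= -iterS iterSr.
Qed.

Lemma smx_app_lin M a x y k : rfin M ->
  smx_app M (fun i => a * x i + y i) k = a * smx_app M x k + smx_app M y k.
Proof.
move=> fM; have [n Hn] := fM k.
rewrite /smx_app !(@fsum_ord _ _ n); [|by move=> l /Hn ->; rewrite mul0r..].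
by rewrite mulr_sumr -big_split; apply: eq_bigr => i _; rewrite mulrDr mulrCA.
Qed.

Lemma smx_app_sum M (I : Type) (r : seq I) (a : I -> R) (x : I -> nat -> R) k :
  rfin M -> smx_app M (fun l => \sum_(i <- r) a i * x i l) k =
  \sum_(i <- r) a i * smx_app M (x i) k.
Proof.
move=> fM; elim: r => [|i r IH].
  rewrite big_nil /smx_app fsbig1// => l _; by rewrite big_nil mulr0.
rewrite big_cons -IH -smx_app_lin//; apply: eq_fsbigr => l _.
by rewrite big_cons.
Qed.

Lemma iter_app_sum M n (I : Type) (r : seq I) (a : I -> R) (x : I -> nat -> R) k :
  rfin M -> iter n (smx_app M) (fun l => \sum_(i <- r) a i * x i l) k =
  \sum_(i <- r) a i * iter n (smx_app M) (x i) k.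
Proof.
move=> fM; elim: n k => [//|n IH] k /=; rewrite -smx_app_sum//.
by congr (smx_app M _ k); apply/funext => l; exact: IH.
Qed.

Lemma papp_app M P v k : rfin M -> papp M P (smx_app M v) k = smx_app M (papp M P v) k.
Proof.
move=> fM; rewrite /papp smx_app_sum//.
by apply: eq_bigr => i _; rewrite -iterSr.
Qed.

Lemma papp_mul M P Q v : rfin M -> papp M (P * Q) v = papp M P (papp M Q v).
Proof.
move=> fM; elim/poly_ind: P Q v => [|P c IH] Q v; apply/funext => k.
  by rewrite mul0r !papp0.
have -> : (P * 'X + c%:P) * Q = P * Q * 'X + c *: Q.
  by rewrite mulrDl mulrAC mul_polyC.
rewrite !pappD papp_mulX IH pappZ pappC papp_mulX; congr (papp M P _ k + _).
by apply/funext => l; exact: papp_app.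
Qed.

Lemma papp_Xn M n v k : papp M 'X^n v k = iter n (smx_app M) v k.
Proof.
rewrite (@pappE _ _ _ _ n.+1) ?size_polyXn// big_ord_recr/= big1 ?add0r.
  by rewrite coefXn eqxx mul1r.
by move=> i _; rewrite coefXn ltn_eqF// mul0r.
Qed.

Lemma smx_app_delta M n k : smx_app M (fun i => (i == n)%:R) k = M k n.
Proof.
rewrite /smx_app (@fsum_ord _ _ n.+1) => [|l nl]; last by rewrite gtn_eqF ?mulr0.
rewrite big_ord_recr/= eqxx mulr1 big1 ?add0r// => l _.
by rewrite ltn_eqF ?mulr0.
Qed.

Lemma smx_app_shift T s x k : rfin T ->
  smx_app (smx_shift T s) x k = smx_app T x k + s * x k.
Proof.
move=> fT; have [n Hn] := fT k; pose m := maxn n k.+1.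
rewrite /smx_app !(@fsum_ord _ _ m).
- rewrite -[X in _ + s * X](_ : \sum_(l < m) smx1 R k l * x l = _).
    rewrite mulr_sumr -big_split; apply: eq_bigr => l _.
    by rewrite /smx_shift mulrDl mulrA.
  have km : (k < m)%N by rewrite leq_max ltnSn orbT.
  rewrite (bigD1 (Ordinal km))//= /smx1 eqxx mul1r big1 ?addr0// => l lk.
  by rewrite eq_sym [_ == _](negPf (_ : l != k :> nat)) ?mul0r//.
- by move=> l; rewrite geq_max => /andP[/Hn -> _]; rewrite mul0r.
- move=> l; rewrite geq_max => /andP[/Hn nl kl].
  by rewrite /smx_shift /smx1 nl ltn_eqF// mulr0 addr0 mul0r.
Qed.

Lemma rfin_shift T s : rfin T -> rfin (smx_shift T s).
Proof.
move=> fT k; have [n Hn] := fT k; exists (maxn n k.+1) => l.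
rewrite geq_max => /andP[/Hn nl kl].
by rewrite /smx_shift /smx1 nl ltn_eqF// mulr0 addr0.
Qed.

(** The passage from [T], to which the recursions belong, to the totally nonnegative T + s I. *)
Lemma papp_shift T s P v : rfin T ->
  papp T P v = papp (smx_shift T s) (P \Po ('X - s%:P)) v.
Proof.
move=> fT; have fS := rfin_shift s fT.
elim/poly_ind: P v => [|P c IH] v; apply/funext => k.
  by rewrite comp_poly0 !papp0.
rewrite comp_polyD comp_polyM comp_polyX comp_polyC !pappD !pappC; congr (_ + _).
rewrite papp_mulX IH papp_mul//; congr (papp _ _ _ k); apply/funext => l.
rewrite pappD -[- s%:P]mulN1r -polyCN mul_polyC pappZ pappC.
rewrite -['X]mul1r papp_mulX pappC mul1r smx_app_shift// mulN1r.
by rewrite addrK.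
Qed.

End Papp.

Section Biorthogonality.
Variable R : realType.
Implicit Types (T : smx R) (u v : nat -> R).

Definition colv p (M : 'M[R]_p) (a : 'I_p) : nat -> R :=
  fun m => if insub m is Some i then M i a else 0.

Lemma colv_ord p (M : 'M[R]_p) (a i : 'I_p) : colv M a i = M i a.
Proof. by rewrite /colv valK. Qed.

(** Strong induction on [k]. For [k < p] this is the product of [invmx A0] and [A0]. Beyond, column
    [n = k - p] of the recursion expands T e_n, which is also column [n] of [T]; the known terms
    cancel and [T k n] can be divided out. *)
Lemma left_recursion_papp p T A0 (A : 'I_p -> nat -> {poly R}) :
  (0 < p)%N -> rfin T -> left_recursion_polys T A0 A ->
  (forall i j, (j + p < i)%N -> T i j = 0) -> (forall n, T (n + p)%N n != 0) ->
  forall k m, \sum_(a < p) papp T (A a k) (colv (invmx A0) a) m = (m == k)%:R.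
Proof.
move=> p0 fT [_ uA A0E AT] bT nT; elim/ltn_ind => k IH m.
have [kp|pk] := ltnP k p.
  transitivity ((if insub m is Some i then (invmx A0 *m A0) i (Ordinal kp) else 0)).
    have [pm|mp] := leqP p m.
      rewrite insubF ?ltnNge ?pm// big1// => a _.
      by rewrite (A0E a (Ordinal kp)) pappC /colv insubF ?ltnNge ?pm// mulr0.
    rewrite insubT mxE; apply: eq_bigr => a _.
    by rewrite (A0E a (Ordinal kp)) pappC (colv_ord _ a (Ordinal mp)) mulrC.
  case: insubP => [i _ <-|]; first by rewrite mulVmx// mxE.
  by rewrite -leqNgt => pm; rewrite gtn_eqF// (leq_trans kp).
pose n := (k - p)%N; have Ek : k = (n + p)%N by rewrite subnK.
pose G j := \sum_(a < p) papp T (A a j) (colv (invmx A0) a) m.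
have : \sum_(j < k.+1) T j n * G j =
    smx_app T (fun i => \sum_(a < p) 1 * papp T (A a n) (colv (invmx A0) a) i) m.
  rewrite smx_app_sum//.
  transitivity (\sum_(a < p) papp T (\sum_(j < k.+1) T j n *: A a j)
      (colv (invmx A0) a) m).
    rewrite /G; under [RHS]eq_bigr => a _ do rewrite papp_sum.
    rewrite exchange_big; apply: eq_bigr => j _ /=; rewrite mulr_sumr.
    by apply: eq_bigr => a _; rewrite pappZ.
  apply: eq_bigr => a _; rewrite mul1r -papp_app// -papp_mulX.
  congr (papp T _ _ m); rewrite mulrC -AT; apply/esym/fsum_ord => j kj.
  by rewrite bT ?scale0r// -Ek.
have -> : (fun i => \sum_(a < p) 1 * papp T (A a n) (colv (invmx A0) a) i) =
    (fun i => (i == n)%:R).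
  apply/funext => i; under eq_bigr => a _ do rewrite mul1r.
  by rewrite IH// Ek -{1}[n]addn0 ltn_add2l.
rewrite smx_app_delta.
have -> : T m n = \sum_(j < k.+1) T j n * (m == j)%:R.
  have [mk|km] := ltnP m k.+1.
    rewrite (bigD1 (Ordinal mk))//= eqxx mulr1 big1 ?addr0// => j /negPf jm.
    by rewrite eq_sym [_ == _]jm mulr0.
  rewrite bT ?big1 -?Ek// => j _; rewrite gtn_eqF ?mulr0//.
  exact: leq_trans km.
rewrite !big_ord_recr /= (eq_bigr (fun j : 'I_k => T j n * (m == j)%:R)).
  by move/addrI; rewrite [in T k n]Ek => /(mulfI (nT n)).
by move=> j _; rewrite /G IH.
Qed.

Definition pairing q (M : 'M[R]_q) (b : 'I_q) (u : nat -> R) : R :=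
  \sum_(k < q) M b k * u k.

(** The dual identity between row vectors, tested on an arbitrary [u]: row [l - q] of the recursion
    isolates the new term, with nonzero coefficient [T (l - q) l]. *)
Lemma right_recursion_papp q T B0 (B : nat -> 'I_q -> {poly R}) :
  (0 < q)%N -> rfin T -> right_recursion_polys T B0 B ->
  (forall i j, (i + q < j)%N -> T i j = 0) -> (forall n, T n (n + q)%N != 0) ->
  forall l u, \sum_(b < q) pairing (invmx B0) b (papp T (B l b) u) = u l.
Proof.
move=> q0 fT [_ uB B0E BT] bT nT; elim/ltn_ind => l IH u.
have [lq|ql] := ltnP l q.
  transitivity (\sum_(k < q) (B0 *m invmx B0) (Ordinal lq) k * u k).
    rewrite /pairing exchange_big; apply: eq_bigr => k _ /=.
    rewrite mxE mulr_suml; apply: eq_bigr => b _.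
    by rewrite (B0E (Ordinal lq) b) pappC mulrCA mulrA.
  rewrite mulmxV// (bigD1 (Ordinal lq))//= mxE eqxx mul1r big1 ?addr0// => k kl.
  by rewrite mxE eq_sym (negPf kl) mul0r.
pose n := (l - q)%N; have El : l = (n + q)%N by rewrite subnK.
have : \sum_(j < l.+1) T n j * \sum_(b < q) pairing (invmx B0) b (papp T (B j b) u) =
    smx_app T u n.
  rewrite -[RHS](IH n); last by rewrite El -{1}[n]addn0 ltn_add2l.
  under eq_bigr => j _ do rewrite mulr_sumr.
  rewrite exchange_big; apply: eq_bigr => b _ /=.
  under eq_bigr => j _ do rewrite /pairing mulr_sumr.
  rewrite exchange_big; apply: eq_bigr => k _ /=.
  under eq_bigr => j _ do rewrite mulrCA.
  rewrite -mulr_sumr -papp_mulX; congr (_ * _).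
  rewrite mulrC -BT (@fsum_ord _ _ l.+1) => [|j lj]; last first.
    by rewrite bT ?scale0r// -El.
  by rewrite papp_sum; apply: eq_bigr => j _; rewrite pappZ.
rewrite /smx_app (@fsum_ord _ _ l.+1) => [|j lj]; last by rewrite bT ?mul0r// -El.
rewrite !big_ord_recr /= (eq_bigr (fun j : 'I_l => T n j * u j)).
  by move/addrI; rewrite [in T n l]El => /(mulfI (nT n)).
by move=> j _; rewrite IH.
Qed.

Definition moment_fun p q T (M : 'M[R]_p) (N : 'M[R]_q) (b : 'I_q) (a : 'I_p)
  (P : {poly R}) : R := pairing N b (papp T P (colv M a)).

Lemma biorthogonality p q T A0 (A : 'I_p -> nat -> {poly R})
    B0 (B : nat -> 'I_q -> {poly R}) :
  (0 < p)%N -> (0 < q)%N -> banded p q T -> rfin T ->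
  left_recursion_polys T A0 A -> right_recursion_polys T B0 B ->
  (forall n, T (n + p)%N n != 0) -> (forall n, T n (n + q)%N != 0) ->
  forall k l, \sum_(a < p) \sum_(b < q)
    moment_fun T (invmx A0) (invmx B0) b a (B l b * A a k) = (k == l)%:R.
Proof.
move=> p0 q0 bT fT hA hB nTp nTq k l; rewrite /moment_fun.
(* [B] acts last: for fixed [a] the sum over [b] extracts coordinate [l], and the sum over [a] then
   yields that coordinate of [e_k]. *)
under eq_bigr => a _ do under eq_bigr => b _ do rewrite papp_mul//.
have bR i j : (i + q < j)%N -> T i j = 0 by move=> ij; rewrite bT ?ij.
have bL i j : (j + p < i)%N -> T i j = 0 by move=> ij; rewrite bT ?ij ?orbT.
under eq_bigr => a _ do rewrite (right_recursion_papp q0 fT hB bR nTq).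
by rewrite (left_recursion_papp p0 fT hA bL nTp) eq_sym.
Qed.

End Biorthogonality.

(** * The moment functionals *)

Section Moments.
Variable R : realType.
Implicit Types (S T W : smx R).

Lemma colv_stair p S (Ls : seq (smx R)) W (Lam A : 'M[R]_p) (a : 'I_p) m :
  left_data S Ls W Lam ->
  colv (Lam *m A) a m = \sum_(k < p) A k a * lprod (take k Ls) m 0%N.
Proof. by move=> dS; rewrite -(stair_mx_sum A dS) (stair_mx_left A dS). Qed.

Lemma upper_TP_ge0 p (A : 'M[R]_p) i j : upper_unitriangular_TP A -> 0 <= A i j.
Proof.
move=> /smx_ext_pTN[_ _ tA _].
have := tA j.+1 1%N (fun=> i) (fun=> j); rewrite /minor det_mx11 mxE smx_ext_ord.
by apply => [[|?] [|?]|[|?] [|?]|].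
Qed.

(** Supplies the factorization required by [krylov_TN] for the [j]-th column of Lambda. *)
Lemma left_data_split p S (Ls : seq (smx R)) W (Lam : 'M[R]_p) (j : 'I_p) :
  left_data S Ls W Lam ->
  exists V', [/\ pTN (lprod (take j Ls)), pTN V' & S = smx_mul (lprod (take j Ls)) V'].
Proof.
move=> [_ bL [pW _] ES _].
have pL : all_smx (@pTN R) Ls by apply: all_smx_imp bL; exact: pos_lower_bd_pTN.
have pl := lprod_pTN (all_smx_take (n := j) pL).
exists (smx_mul (lprod (drop j Ls)) W); split => //.
  by apply: pTN_mul => //; exact: lprod_pTN (all_smx_drop (n := j) pL).
rewrite ES -{1}(cat_take_drop j Ls) lprod_cat; [|exact: all_smx_take|exact: all_smx_drop].
by rewrite smx_mulA//; [case: pl | case: (lprod_pTN (all_smx_drop (n := j) pL))].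
Qed.

(** With [Q] the shifted polynomial, both vectors expand over first columns of partial products with
    the nonnegative entries of [A] and [B]. The value is thus a nonnegative combination of the forms
    of [hankel_psd] at the coefficients of [Q]. *)
Lemma moment_fun_sqr_ge0 p q T s (Ls Rs : seq (smx R)) W W'
    (Lam A : 'M[R]_p) (Lam' B M : 'M[R]_q) b a (P : {poly R}) :
  rfin T -> left_data (smx_shift T s) Ls W Lam ->
  left_data (smx_tr (smx_shift T s)) Rs W' Lam' ->
  upper_unitriangular_TP A -> upper_unitriangular_TP B -> M^T = Lam' *m B ->
  0 <= moment_fun T (Lam *m A) M b a (P * P).
Proof.
move=> fT dS dS' tA tB EM; set S := smx_shift T s in dS dS' *.
have fS : rfin S by exact: rfin_shift.
pose Q := P \Po ('X - s%:P); pose n := size Q.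
pose v (j : 'I_p) i := lprod (take j Ls) i 0%N.
pose w (j : 'I_q) i := lprod (take j Rs) i 0%N.
have -> : moment_fun T (Lam *m A) M b a (P * P) =
  \sum_(i < q) \sum_(j < p) B i b * A j a *
   \sum_(c < n) \sum_(d < n) Q`_c * Q`_d *
     \sum_(k \in [set: nat]) w i k * iter (c + d) (smx_app S) (v j) k.
  have E k : papp T (P * P) (colv (Lam *m A) a) k =
     \sum_(j < p) A j a * \sum_(c < n) \sum_(d < n) Q`_c * Q`_d *
       iter (c + d) (smx_app S) (v j) k.
    rewrite (papp_shift s _ _ fT) comp_polyM papp_mul// -/Q.
    transitivity (\sum_(c < n) \sum_(d < n) \sum_(j < p) Q`_c * Q`_d * (A j a *
       iter (c + d) (smx_app S) (v j) k)).
      rewrite /papp; apply: eq_bigr => c _; rewrite iter_app_sum// mulr_sumr.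
      apply: eq_bigr => d _; rewrite -iterD mulrA -mulr_sumr -iter_app_sum//.
      congr (_ * iter _ _ _ k); apply/funext => m; exact: (colv_stair A a m dS).
    under eq_bigr => c _ do rewrite exchange_big /=.
    rewrite exchange_big /=; apply: eq_bigr => j _.
    rewrite mulr_sumr; apply: eq_bigr => c _.
    by rewrite mulr_sumr; apply: eq_bigr => d _; rewrite mulrCA.
  have Ek (k : 'I_q) : M b k = \sum_(i < q) B i b * w i k.
    by rewrite -(colv_stair B b k dS') -EM colv_ord mxE.
  rewrite /moment_fun /pairing.
  transitivity (\sum_(k < q) \sum_(i < q) \sum_(j < p) B i b * A j a *
    \sum_(c < n) \sum_(d < n) Q`_c * Q`_d *
     (w i k * iter (c + d) (smx_app S) (v j) k)).
    apply: eq_bigr => k _; rewrite E Ek mulr_suml; apply: eq_bigr => i _.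
    rewrite mulr_sumr; apply: eq_bigr => j _.
    rewrite mulrACA; congr (_ * _).
    rewrite mulr_sumr; apply: eq_bigr => c _; rewrite mulr_sumr; apply: eq_bigr => d _.
    by rewrite mulrCA !mulrA.
  rewrite exchange_big; apply: eq_bigr => i _ /=.
  rewrite exchange_big; apply: eq_bigr => j _ /=.
  rewrite -mulr_sumr exchange_big; congr (_ * _); apply: eq_bigr => c _ /=.
  rewrite exchange_big; apply: eq_bigr => d _ /=.
  rewrite -mulr_sumr; congr (_ * _); apply/esym/fsum_ord => k qk.
  by rewrite /w (lprod_take_col0 dS')// mul0r.
apply: sumr_ge0 => i _; apply: sumr_ge0 => j _.
rewrite mulr_ge0// ?mulr_ge0 ?upper_TP_ge0//.
have [V' [pV pV' ES]] := left_data_split j dS.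
have [U' [pU pU' ES']] := left_data_split i dS'.
exact: (hankel_psd n (fun i => Q`_i) pV pV' ES (fun _ => erefl) pU pU' ES' (fun _ => erefl)).
Qed.

(** The unit vector [e] has norm 1 and its image is column [k], whose norm dominates each of its
    entries. *)
Lemma bounded_operator_entries T : bounded_operator T ->
  exists2 C, 0 <= C & forall i k, `|T i k| <= C.
Proof.
have nge0 (x : nat -> R) (k : nat) : (0 <= `|(EFin \o x) k| `^ 2)%E by exact: poweR_ge0.
have l2E (x : nat -> R) : l2norm x = ((\sum_(k <oo) (`|(EFin \o x) k| `^ 2)) `^ 2^-1)%E.
  by rewrite /l2norm Lnorm_counting.
move=> [C HC]; exists `|C| => // i k.
pose e := (fun m => (m == k)%:R) : nat -> R.
have ne : l2norm e = 1%E.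
  rewrite l2E (@nneseriesD1 _ _ k)//= /e eqxx normr1 powR1.
  rewrite eseries0 ?adde0 ?poweR_EFin ?powR1// => m _ /= /negPf ->.
  by rewrite normr0 powR0.
have := HC e; rewrite ne ltry mule1 => /(_ isT) H.
have : (`|T i k|%:E <= l2norm (smx_app T e))%E.
  rewrite l2E -[leLHS](_ : ((`|T i k|%:E `^ 2) `^ 2^-1)%E = _).
    apply: gt0_ler_poweR; rewrite ?invr_ge0//.
    - by rewrite in_itv/= leey andbT lee_fin powR_ge0.
    - by rewrite in_itv/= leey andbT nneseries_ge0.
    rewrite (@nneseriesD1 _ _ i)//= smx_app_delta leeDl//.
    by apply: nneseries_ge0.
  by rewrite /= -powRrM divff// powRr1.
move=> /le_trans/(_ H); rewrite lee_fin => /le_trans; apply; exact: ler_norm.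
Qed.

Lemma banded_bound p q T : banded p q T -> bounded_operator T ->
  exists2 K, 0 <= K & forall (x : nat -> R) B, (forall k, `|x k| <= B) ->
    forall k, `|smx_app T x k| <= K * B.
Proof.
move=> bT /bounded_operator_entries[C C0 HC].
(* A row has at most p + q + 1 nonzero entries; this bounds [T] in the sup norm. *)
exists (C *+ (p + q).+1); first by rewrite mulrn_wge0.
move=> x B xB k; have B0 : 0 <= B by apply: le_trans (xB 0%N).
rewrite /smx_app (@fsum_ord _ _ (k + q).+1) => [|l kl]; last first.
  by rewrite bT ?mul0r// kl.
rewrite -(big_mkord xpredT (fun l => T k l * x l)).
rewrite (@big_cat_nat _ _ _ (k - p)%N)//=; last lia.
rewrite big_nat big1 ?add0r => [|l /andP[_ lk]]; last first.
  by rewrite bT ?mul0r//; apply/orP; right; lia.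
rewrite (le_trans (ler_norm_sum _ _ _))//.
apply: (@le_trans _ _ (\sum_(k - p <= l < (k + q).+1) C * B)).
  by apply: ler_sum => l _; rewrite normrM ler_pM.
rewrite sumr_const_nat -mulrnAl ler_wpM2r// ler_wpMn2l//; lia.
Qed.

(** [K] is chosen before [b] and [a] because a single interval must carry all the measures. Adding 1
    to the sup-norm bound makes it positive. *)
Lemma moment_fun_growth p q T (M : 'M[R]_p) (N : 'M[R]_q) :
  banded p q T -> bounded_operator T ->
  exists2 K, 1 <= K & forall b a, exists C,
    forall n, `|moment_fun T M N b a 'X^n| <= C * K ^+ n.
Proof.
move=> bT /(banded_bound bT)[K0 K0_ge0 HK0].
pose K := K0 + 1; have K1 : 1 <= K by rewrite lerDr.
exists K => // b a.
pose B := \sum_(i < p) `|M i a|.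
have B0 : 0 <= B by exact: sumr_ge0.
have vB k : `|colv M a k| <= B.
  rewrite /colv; case: insub => [i|]; last by rewrite normr0.
  by rewrite /B (bigD1 i)//= lerDl sumr_ge0.
pose W := \sum_(k < q) `|N b k|.
exists (W * B) => n.
have H : forall k, `|iter n (smx_app T) (colv M a) k| <= B * K ^+ n.
  elim: n => [|n IH] k; first by rewrite expr0 mulr1 vB.
  rewrite exprS mulrCA; apply: le_trans (HK0 _ _ IH k) _.
  by rewrite ler_wpM2r ?lerDl// mulr_ge0// exprn_ge0// (le_trans ler01).
rewrite /moment_fun /pairing (le_trans (ler_norm_sum _ _ _))// -mulrA mulr_suml.
by apply: ler_sum => k _; rewrite normrM ler_wpM2l//; rewrite papp_Xn; exact: H.
Qed.

Lemma moment_fun_lin p q T (M : 'M[R]_p) (N : 'M[R]_q) b a c P Q :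
  moment_fun T M N b a (c *: P + Q) =
  c * moment_fun T M N b a P + moment_fun T M N b a Q.
Proof.
rewrite /moment_fun /pairing mulr_sumr -big_split; apply: eq_bigr => k _ /=.
by rewrite papp_lin mulrDr mulrCA.
Qed.

End Moments.

(** * The moment problem on a compact interval *)

Section PositiveFunctional.
Variable R : realType.
Implicit Types (L : {poly R} -> R) (P Q : {poly R}) (K c : R).

(** Stable, with the same [K], under weighting by a square, by K + X and by K - X. Only [C] changes,
    hence its existential form. *)
Definition pos_functional K L := [/\
  forall c P Q, L (c *: P + Q) = c * L P + L Q,
  forall P, 0 <= L (P * P) &
  exists C, forall n, `|L 'X^n| <= C * K ^+ n].

Section Linear.
Variable L : {poly R} -> R.
Hypothesis Llin : forall c P Q, L (c *: P + Q) = c * L P + L Q.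

Lemma lf0 : L 0 = 0.
Proof. by have := Llin 1 0 0; rewrite scaler0 addr0 mul1r => /eqP; rewrite -subr_eq subrr => /eqP. Qed.

Lemma lfD P Q : L (P + Q) = L P + L Q.
Proof. by rewrite -[P]scale1r Llin mul1r scale1r. Qed.

Lemma lfZ c P : L (c *: P) = c * L P.
Proof. by rewrite -[c *: P]addr0 Llin lf0 addr0. Qed.

Lemma lfN P : L (- P) = - L P.
Proof. by rewrite -scaleN1r lfZ mulN1r. Qed.

Lemma lf_sum (I : Type) (r : seq I) (F : I -> {poly R}) :
  L (\sum_(i <- r) F i) = \sum_(i <- r) L (F i).
Proof.
elim: r => [|i r IH]; first by rewrite !big_nil lf0.
by rewrite !big_cons lfD IH.
Qed.

Lemma lf_cauchy_schwarz n : (forall P, 0 <= L (P * P)) ->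
  L 'X^n ^+ 2 <= L 1 * L 'X^(n + n).
Proof.
move=> sq.
have H t : 0 <= L 'X^(n + n) - 2 * t * L 'X^n + t ^+ 2 * L 1.
  have := sq ('X^n - t%:P).
  suff -> : ('X^n - t%:P) * ('X^n - t%:P) =
     'X^(n + n) + ((- (2 * t)) *: 'X^n + (t ^+ 2) *: 1).
    by rewrite !lfD !lfZ => H; apply: le_trans H _; rewrite mulNr addrA.
  rewrite exprD -!mul_polyC !polyCN !polyCM; ring.
have [L10|L10] := eqVneq (L 1) 0.
  rewrite L10 mul0r; have [->|Xn] := eqVneq (L 'X^n) 0; first by rewrite expr2 mul0r.
  (* When [L 1 = 0] the expression is affine in [t], and this [t] gives it the value -1. *)
  exfalso; have := H ((L 'X^(n + n) + 1) / (2 * L 'X^n)).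
  rewrite L10 mulr0 addr0.
  have -> : 2 * ((L 'X^(n + n) + 1) / (2 * L 'X^n)) * L 'X^n = L 'X^(n + n) + 1 by field.
  lra.
have L1p : 0 < L 1 by rewrite lt_neqAle eq_sym L10 -[1]mulr1 sq.
have := H (L 'X^n / L 1).
rewrite -(pmulr_rge0 _ L1p).
have -> : L 1 * (L 'X^(n + n) - 2 * (L 'X^n / L 1) * L 'X^n + (L 'X^n / L 1) ^+ 2 * L 1) =
  L 1 * L 'X^(n + n) - L 'X^n ^+ 2 by field.
by rewrite subr_ge0.
Qed.

End Linear.

Lemma expr_unbounded (u M : R) : 1 < u -> exists k, M < u ^+ (2 ^ k).
Proof.
move=> u1; have u0 : 0 < u - 1 by rewrite subr_gt0.
have bern n : 1 + n%:R * (u - 1) <= u ^+ n.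
  elim: n => [|n IH]; first by rewrite mul0r addr0 expr0.
  have n0 : 0 <= n%:R :> R by [].
  have : (1 + n%:R * (u - 1)) * u <= u ^+ n * u by apply: ler_wpM2r => //; apply: ltW; exact: lt_trans u1.
  rewrite -exprSr; apply: le_trans; rewrite -subr_ge0 -natr1.
  have -> : (1 + n%:R * (u - 1)) * u - (1 + (n%:R + 1) * (u - 1)) =
    n%:R * (u - 1) ^+ 2 by ring.
  by rewrite mulr_ge0 ?sqr_ge0.
pose k := Num.bound `|M / (u - 1)|; exists k.
have Hk : M / (u - 1) < k%:R.
  by apply: le_lt_trans (ler_norm _) _; exact/archi_boundP/normr_ge0.
rewrite ltr_pdivrMr// in Hk; apply: (lt_le_trans Hk).
have k2 : (k <= 2 ^ k)%N by rewrite ltnW// ltn_expl.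
apply: le_trans (bern _); rewrite -[leLHS]add0r lerD// ler_wpM2r ?ler_nat//.
exact: ltW.
Qed.

(** Otherwise [u = |L 'X| / L 1] exceeds [K], and Cauchy-Schwarz, which doubles the exponent at each
    use, gives moments of order 2^k at least [L 1 * u ^+ (2 ^ k)], against the growth bound. *)
Lemma pos_functional_X K L : 0 < K -> pos_functional K L -> `|L 'X| <= K * L 1.
Proof.
move=> K0 [lin sq [C HC]].
have L1 : 0 <= L 1 by rewrite -[1]mulr1 sq.
rewrite leNgt; apply/negP => H.
have L1p : 0 < L 1.
  rewrite lt_neqAle L1 andbT; apply: contraTneq H => E.
  have := lf_cauchy_schwarz lin 1 sq; rewrite -E mul0r expr1 mulr0 -leNgt => X2.
  have /eqP : L 'X ^+ 2 = 0 by apply/eqP; rewrite eq_le X2 sqr_ge0.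
  by rewrite sqrf_eq0 => /eqP ->; rewrite normr0.
pose u := `|L 'X| / L 1.
have uK : K < u by rewrite ltr_pdivlMr.
have Hk k : L 1 * u ^+ (2 ^ k) <= `|L 'X^(2 ^ k)|.
  elim: k => [|k IH]; first by rewrite expn0 !expr1 mulrC divfK// gt_eqF.
  have := lf_cauchy_schwarz lin (2 ^ k) sq.
  rewrite addnn -mul2n -expnS => CS.
  rewrite -(ler_pM2l L1p); apply: le_trans (_ : L 1 * L 'X^(2 ^ k.+1) <= _); last first.
    by rewrite ler_wpM2l// ler_norm.
  apply: le_trans CS; rewrite -real_normK ?num_real//.
  have -> : L 1 * (L 1 * u ^+ (2 ^ k.+1)) = (L 1 * u ^+ (2 ^ k)) ^+ 2.
    by rewrite expnSr exprM mulrA -expr2 -exprMn.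
  rewrite ler_sqr ?nnegrE// mulr_ge0// exprn_ge0// (le_trans (ltW K0))// ltW//.
have uK1 : 1 < u / K by rewrite ltr_pdivlMr// mul1r.
have [k] := expr_unbounded (C / L 1) uK1.
rewrite expr_div_n ltr_pdivlMr ?exprn_gt0// mulrAC ltr_pdivrMr//.
by rewrite ltNge mulrC (le_trans (Hk k) (HC _)).
Qed.

Lemma pos_functional_mulsq K L P : 0 <= K -> pos_functional K L ->
  pos_functional K (fun Q => L (Q * (P * P))).
Proof.
move=> K0 [lin sq [C HC]]; split.
- by move=> c Q1 Q2; rewrite mulrDl -scalerAl lin.
- by move=> Q; rewrite mulrACA sq.
- pose W := P * P; exists (\sum_(i < size W) `|W`_i| * (C * K ^+ i)) => n.
  have E : W = \sum_(i < size W) W`_i *: 'X^i by rewrite -poly_def coefK.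
  rewrite -/W {1}E mulr_sumr lf_sum//.
  rewrite (le_trans (ler_norm_sum _ _ _))// mulr_suml; apply: ler_sum => i _.
  rewrite -scalerAr -exprD lfZ// normrM -mulrA ler_wpM2l// (le_trans (HC _))//.
  by rewrite exprD mulrA mulrAC.
Qed.

(** On squares, [pos_functional_X] for the functional weighted by [P * P] bounds the contribution of
    X by that of [K], whatever the sign. *)
Lemma pos_functional_affine K L (e : bool) : 0 < K -> pos_functional K L ->
  pos_functional K (fun Q => L ((K%:P + (-1) ^+ e * 'X) * Q)).
Proof.
move=> K0 pL; have [lin sq [C HC]] := pL; split.
- by move=> c Q1 Q2; rewrite mulrDr -scalerAr lin.
- move=> P; have pLP := pos_functional_mulsq P (ltW K0) pL.
  have := pos_functional_X K0 pLP; rewrite mul1r => H.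
  rewrite mulrDl lfD// mul_polyC lfZ//.
  case: e; rewrite ?expr1 ?expr0 ?mul1r ?mulN1r ?mulNr ?lfN//; move: H;
    rewrite ler_norml => /andP[]; lra.
- exists (2 * C * K) => n.
  rewrite mulrDl mul_polyC lfD// lfZ// (le_trans (ler_normD _ _))//.
  have -> : `|L ((-1) ^+ e * 'X * 'X^n)| = `|L 'X^(n.+1)|.
    by case: e; rewrite ?expr1 ?expr0 ?mul1r ?mulN1r ?mulNr ?lfN// ?normrN exprS.
  rewrite normrM (gtr0_norm K0).
  have H1 := HC n.+1; rewrite [K ^+ n.+1]exprS in H1.
  have H2 := ler_wpM2l (ltW K0) (HC n); apply: le_trans (lerD H2 H1) _.
  rewrite le_eqVlt; apply/orP; left; apply/eqP; ring.
Qed.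

Lemma pos_functional_bernstein K L k m : 0 < K -> pos_functional K L ->
  0 <= L ((K%:P + 'X) ^+ k * (K%:P - 'X) ^+ m).
Proof.
move=> K0; elim: k L => [|k IH] L pL.
  rewrite expr0 mul1r; elim: m L pL => [|m IH] L pL.
    by have [_ sq _] := pL; rewrite expr0 -[1]mulr1 sq.
  have := IH _ (pos_functional_affine true K0 pL).
  by rewrite expr1 mulN1r -exprS.
have := IH _ (pos_functional_affine false K0 pL).
by rewrite expr0 mul1r mulrA -exprS.
Qed.

End PositiveFunctional.

Lemma ultra_fmap (T U : Type) (f : T -> U) (F : set_system T) :
  UltraFilter F -> UltraFilter (f @ F).
Proof.
move=> uF; have pF := ultra_proper (F := F).
constructor; first exact: fmap_proper_filter.
move=> G pG FG; apply/seteqP; split=> A; last exact: FG.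
move=> GA; have [//|nA] := in_ultra_setVsetC (f @^-1` A) uF.
have GnA : G (~` A) by apply: FG.
exfalso; have : G set0 by rewrite -(setICr A); exact: filterI.
exact: filter_not_empty.
Qed.

(** Factorial moments of the binomial law, in any commutative ring so that [Y] and [Z] can be
    polynomials. Falling factorials give a closed form without lower order terms. *)
Lemma bernstein_ffact (R : comNzRingType) (Y Z : R) (N j : nat) : Y + Z = 1 ->
  \sum_(k < N.+1) ('C(N, k) * k ^_ j)%:R * (Y ^+ k * Z ^+ (N - k)) =
  (N ^_ j)%:R * Y ^+ j.
Proof.
move=> YZ; elim: j N => [|j IH] N.
  have E : (Z + Y) ^+ N = 1 by rewrite addrC YZ expr1n.
  transitivity ((Z + Y) ^+ N); last by rewrite E ffactn0 mul1r expr0.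
  rewrite exprDn.
  by apply: eq_bigr => k _; rewrite ffactn0 muln1 mulr_natl mulrC.
rewrite big_ord_recl ffact0n muln0 mul0r add0r.
case: N => [|n]; first by rewrite big_ord0 ffact0n mul0r.
rewrite ffactSS natrM exprS mulrACA -IH mulr_sumr; apply: eq_bigr => k _.
rewrite lift0 ffactSS subSS mulnA [('C(_, _) * _)%N]mulnC -mul_bin_diag /= exprS !natrM; ring.
Qed.

(** * Bernstein discretizations of a positive functional and their limit *)

Section Bernstein.
Variable R : realType.
Variables (K : R) (L : {poly R} -> R).
Hypotheses (K0 : 0 < K) (pL : pos_functional K L).

Let Llin : forall c P Q, L (c *: P + Q) = c * L P + L Q.
Proof. by case: pL. Qed.

Let Y : {poly R} := (2 * K)^-1 *: (K%:P + 'X).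
Let Z : {poly R} := (2 * K)^-1 *: (K%:P - 'X).

Let YZ : Y + Z = 1.
Proof.
rewrite /Y /Z -scalerDr addrACA subrr addr0 -polyCD -mul_polyC -polyCM.
by congr (_%:P); field; rewrite ?gt_eqF.
Qed.

Definition bweight (N k : nat) : R := 'C(N, k)%:R * L (Y ^+ k * Z ^+ (N - k)).

Definition bnode (N k : nat) : R := - K + 2 * K * (k%:R / N%:R).

Lemma bweight_ge0 N k : 0 <= bweight N k.
Proof.
rewrite mulr_ge0// /Y /Z !exprZn -scalerAl -scalerAr scalerA lfZ// mulr_ge0//.
  by rewrite mulr_ge0// exprn_ge0// invr_ge0 mulr_ge0// ltW.
exact: pos_functional_bernstein.
Qed.

Lemma bweight_ffact N j :
  \sum_(k < N.+1) bweight N k * (k ^_ j)%:R = (N ^_ j)%:R * L (Y ^+ j).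
Proof.
rewrite -lfZ//.
have -> : ((N ^_ j)%:R : R) *: Y ^+ j = (N ^_ j)%:R * Y ^+ j.
  by rewrite scaler_nat mulr_natl.
rewrite -(bernstein_ffact _ _ YZ) lf_sum//; apply: eq_bigr => k _.
have -> V : ('C(N, k) * k ^_ j)%:R * V = (('C(N, k) * k ^_ j)%:R : R) *: V :> {poly R}.
  by rewrite scaler_nat mulr_natl.
by rewrite lfZ// /bweight natrM mulrAC.
Qed.

Lemma sum_bweight N : \sum_(k < N.+1) bweight N k = L 1.
Proof.
have := bweight_ffact N 0; rewrite expr0 ffactn0 mul1r => <-.
by apply: eq_bigr => k _; rewrite ffactn0 mulr1.
Qed.

(** Links factorial moments ([i = 0]), known exactly, to power moments ([j = 0]), needed in the
    limit. A factor [k] raises the order of the falling factorial, up to a remainder with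
    coefficient [j / n.+1]. *)
Let mixed i j (n : nat) : R := \sum_(k < n.+2) bweight n.+1 k *
  ((k%:R / n.+1%:R) ^+ i * ((k ^_ j)%:R / n.+1%:R ^+ j)).

Let harmonic_mul_cvg j : (j%:R * n.+1%:R^-1 : R) @[n --> \oo] --> (0 : R).
Proof.
by have := cvgM (cvg_cst (j%:R : R)) (@cvg_harmonic R); rewrite mulr0; exact.
Qed.

Let ffact_ratio_cvg j : ((n.+1 ^_ j)%:R / n.+1%:R ^+ j : R) @[n --> \oo] --> (1 : R).
Proof.
elim: j => [|j IH].
  under eq_fun => n do rewrite ffactn0 expr0 divr1; exact: cvg_cst.
have E n : (n.+1 ^_ j.+1)%:R / n.+1%:R ^+ j.+1 =
    (n.+1 ^_ j)%:R / n.+1%:R ^+ j * (1 - j%:R * n.+1%:R^-1) :> R.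
  have n0 : n.+1%:R != 0 :> R by [].
  rewrite ffactnSr natrM exprS.
  have [jn|nj] := leqP j n.+1.
    rewrite natrB//; move: (n.+1%:R : R) n0 => x x0.
    by field; rewrite ?expf_neq0 ?x0.
  by rewrite ffact_small// !mul0r.
under eq_fun => n do rewrite E.
have := cvgM IH (cvgB (cvg_cst (1 : R)) (harmonic_mul_cvg j)).
by rewrite subr0 mulr1; exact.
Qed.

Let mixed_cvg i j : mixed i j n @[n --> \oo] --> L (Y ^+ (i + j)).
Proof.
elim: i j => [|i IH] j.
  have E n : mixed 0 j n = (n.+1 ^_ j)%:R / n.+1%:R ^+ j * L (Y ^+ j).
    rewrite mulrAC -bweight_ffact mulr_suml; apply: eq_bigr => k _.
    by rewrite expr0 mul1r mulrA.
  under eq_fun => n do rewrite E.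
  by have := cvgM (ffact_ratio_cvg j) (cvg_cst (L (Y ^+ j))); rewrite mul1r; exact.
have E n : mixed i.+1 j n = mixed i j.+1 n + j%:R * n.+1%:R^-1 * mixed i j n.
  rewrite /mixed mulr_sumr -big_split; apply: eq_bigr => k _ /=.
  have n0 : n.+1%:R != 0 :> R by [].
  have -> : (k ^_ j.+1)%:R = k%:R * (k ^_ j)%:R - j%:R * (k ^_ j)%:R :> R.
    rewrite ffactnSr; have [jk|kj] := leqP j k.
      by rewrite natrM natrB//; ring.
    by rewrite ffact_small// mul0n !mulr0 subr0.
  rewrite !exprS; move: (n.+1%:R : R) n0 => x x0.
  by rewrite !expr_div_n; field; rewrite ?expf_neq0 ?x0.
under eq_fun => n do rewrite E.
have := cvgD (IH j.+1) (cvgM (harmonic_mul_cvg j) (IH j)).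
by rewrite mul0r addr0 addSnnS; exact.
Qed.

(** [V] inverts [Y]: in the coordinate [Y] the nodes are [k / n.+1], and [P] is a combination of
    powers, each covered by [mixed_cvg]. *)
Lemma bernstein_cvg (P : {poly R}) :
  \sum_(k < n.+2) bweight n.+1 k * P.[bnode n.+1 k] @[n --> \oo] --> L P.
Proof.
pose V : {poly R} := (2 * K) *: 'X - K%:P; pose Q := P \Po V.
have VY : V \Po Y = 'X.
  rewrite /V comp_polyB comp_polyZ comp_polyX comp_polyC /Y scalerA.
  rewrite divff ?gt_eqF ?mulr_gt0// scale1r.
  by rewrite addrAC subrr add0r.
have EP : P = \sum_(i < size Q) Q`_i *: Y ^+ i.
  by rewrite -comp_polyE /Q -comp_polyA VY comp_polyXr.
have EL : L P = \sum_(i < size Q) Q`_i * L (Y ^+ i).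
  by rewrite {1}EP lf_sum//; apply: eq_bigr => i _; rewrite lfZ.
have EN n : \sum_(k < n.+2) bweight n.+1 k * P.[bnode n.+1 k] =
    \sum_(i < size Q) Q`_i * mixed i 0 n.
  transitivity (\sum_(k < n.+2) \sum_(i < size Q)
     Q`_i * (bweight n.+1 k * (k%:R / n.+1%:R) ^+ i)).
    apply: eq_bigr => k _.
    have -> : P.[bnode n.+1 k] = Q.[k%:R / n.+1%:R].
      rewrite /Q horner_comp; congr (P.[_]).
      by rewrite /V hornerD hornerN hornerC hornerZ hornerX /bnode addrC.
    by rewrite horner_coef mulr_sumr; apply: eq_bigr => i _; rewrite mulrCA.
  rewrite exchange_big; apply: eq_bigr => i _; rewrite -mulr_sumr; congr (_ * _).
  by apply: eq_bigr => k _; rewrite ffactn0 expr0 divr1 mulr1.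
under eq_fun => n do rewrite EN.
rewrite EL; apply: (@cvg_big R 'I_(size Q) +%R 0 xpredT add_continuous) => i _.
apply: cvgM; first exact: cvg_cst.
by rewrite -{2}[nat_of_ord i]addn0; exact: mixed_cvg.
Qed.

Definition bdistr (N : nat) (t : R) : R :=
  \sum_(k < N.+1) bweight N k * (bnode N k <= t)%R%:R.

Lemma bnode_itv N k : (k <= N)%N -> - K <= bnode N k <= K.
Proof.
move=> kN; rewrite /bnode.
have : 0 <= (k%:R / N%:R : R) <= 1.
  apply/andP; split; first by rewrite divr_ge0.
  have [E|N0] := posnP N.
    by rewrite (_ : N%:R = 0 :> R) ?E// invr0 mulr0 ler01.
  by rewrite ler_pdivrMr ?ltr0n// mul1r ler_nat.
move: (_ / _) => y /andP[y0 y1].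
have Ky0 : 0 <= K * y by rewrite mulr_ge0// ltW.
have Ky1 : K * y <= K by rewrite ler_piMr// ltW.
by apply/andP; split; lra.
Qed.

Lemma bdistr_mono N : {homo bdistr N : x y / x <= y}.
Proof.
move=> x y xy; apply: ler_sum => k _; rewrite ler_wpM2l ?bweight_ge0// ler_nat.
by case: (leP _ x) => // H; rewrite (le_trans H xy).
Qed.

Lemma bdistr_lt N t : t < - K -> bdistr N t = 0.
Proof.
move=> tK; apply: big1 => k _; have /andP[H _] := bnode_itv (ltn_ord k : k <= N)%N.
by rewrite leNgt (lt_le_trans tK H) mulr0.
Qed.

Lemma bdistr_ge N t : K <= t -> bdistr N t = L 1.
Proof.
move=> tK; rewrite -(sum_bweight N); apply: eq_bigr => k _.
have /andP[_ H] := bnode_itv (ltn_ord k : k <= N)%N.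
by rewrite (le_trans H tK) mulr1.
Qed.

Lemma bdistr_itv N t : 0 <= bdistr N t <= L 1.
Proof.
apply/andP; split.
  by apply: sumr_ge0 => k _; rewrite mulr_ge0// bweight_ge0.
rewrite -(sum_bweight N); apply: ler_sum => k _.
by rewrite -[leRHS]mulr1 ler_wpM2l ?bweight_ge0// lern1 leq_b1.
Qed.

(** The error is uniform in [N], hence survives the limit. As [bdistr] counts nodes [<= t], the
    partition starts strictly left of [- K] so that the indicators telescope to 1. *)
Lemma bdistr_stieltjes N (P : {poly R}) (m : nat) (t c : nat -> R) e :
  (forall i, t i <= t i.+1) -> t 0%N < - K -> K <= t m ->
  (forall i x, (i < m)%N -> t i < x <= t i.+1 -> - K <= x <= K -> `|P.[x] - c i| <= e) ->
  `|\sum_(k < N.+1) bweight N k * P.[bnode N k] -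
    \sum_(i < m) c i * (bdistr N (t i.+1) - bdistr N (t i))| <= e * L 1.
Proof.
move=> tt t0 tm H.
pose ind k s : R := (bnode N k <= s)%R%:R.
have E1 k : (k < N.+1)%N -> P.[bnode N k] =
    \sum_(i < m) P.[bnode N k] * (ind k (t i.+1) - ind k (t i)).
  move=> kN; rewrite -mulr_sumr -(big_mkord xpredT (fun i => ind k (t i.+1) - ind k (t i))).
  rewrite telescope_sumr//; have /andP[H1 H2] := bnode_itv (kN : k <= N)%N.
  rewrite /ind (le_trans H2 tm) leNgt (lt_le_trans t0 H1) subr0 mulr1//.
have E2 : \sum_(k < N.+1) bweight N k * P.[bnode N k] -
    \sum_(i < m) c i * (bdistr N (t i.+1) - bdistr N (t i)) =
    \sum_(k < N.+1) bweight N k *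
      \sum_(i < m) (P.[bnode N k] - c i) * (ind k (t i.+1) - ind k (t i)).
  transitivity (\sum_(k < N.+1) bweight N k * P.[bnode N k] -
     \sum_(k < N.+1) bweight N k * \sum_(i < m) c i * (ind k (t i.+1) - ind k (t i))).
    congr (_ - _); under [RHS]eq_bigr => k _ do rewrite mulr_sumr.
    rewrite exchange_big; apply: eq_bigr => i _ /=.
    rewrite /bdistr -sumrB mulr_sumr; apply: eq_bigr => k _.
    by rewrite -mulrBr mulrCA.
  rewrite -sumrB; apply: eq_bigr => k _; rewrite -mulrBr; congr (_ * _).
  by rewrite {1}E1// -sumrB; apply: eq_bigr => i _; rewrite mulrBl.
rewrite E2 -(sum_bweight N) mulr_sumr (le_trans (ler_norm_sum _ _ _))//.
apply: ler_sum => k _; rewrite normrM ger0_norm ?bweight_ge0// mulrC.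
rewrite ler_wpM2r ?bweight_ge0// (le_trans (ler_norm_sum _ _ _))//.
have Kk := bnode_itv (ltn_ord k : k <= N)%N.
apply: (@le_trans _ _ (\sum_(i < m) e * (ind k (t i.+1) - ind k (t i)))).
  apply: ler_sum => i _; rewrite normrM /ind.
  have [xi|xi] := leP (bnode N k) (t i).
    by rewrite (le_trans xi (tt i)) subrr normr0 !mulr0.
  have [xi1|xi1] := leP (bnode N k) (t i.+1); last by rewrite subrr normr0 !mulr0.
  by rewrite subr0 normr1 !mulr1 H// xi.
rewrite -mulr_sumr -(big_mkord xpredT (fun i => ind k (t i.+1) - ind k (t i))).
rewrite telescope_sumr//; have /andP[H1 H2] := Kk.
by rewrite /ind (le_trans H2 tm) [_ <= t 0%N]leNgt (lt_le_trans t0 H1) subr0 mulr1.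
Qed.

(* A compactness substitute for Helly's selection theorem: the distribution
   functions converge pointwise along an ultrafilter. *)
Lemma limit_distr : exists F : R -> R, [/\ {homo F : x y / x <= y},
  forall t, t < - K -> F t = 0, forall t, K <= t -> F t = L 1 &
  forall (P : {poly R}) (m : nat) (t c : nat -> R) e,
  (forall i, t i <= t i.+1) -> t 0%N < - K -> K <= t m ->
  (forall i x, (i < m)%N -> t i < x <= t i.+1 -> - K <= x <= K -> `|P.[x] - c i| <= e) ->
  `|L P - \sum_(i < m) c i * (F (t i.+1) - F (t i))| <= e * L 1].
Proof.
have [U [uU ooU]] := ultraFilterLemma (eventually_filter : ProperFilter \oo).
have pU : ProperFilter U := @ultra_proper _ U uU.
have /choice[F HF] : forall t, exists l : R, bdistr n.+1 t @[n --> U] --> l.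
  (* All values lie in the compact segment from 0 to [L 1], where the image ultrafilter
     converges. *)
  move=> t; have := @segment_compact R 0 (L 1); rewrite compact_ultra.
  move=> /(_ (bdistr n.+1 t @[n --> U]) (ultra_fmap _ uU)).
  have : (bdistr n.+1 t @[n --> U]) `[0, L 1]%classic.
    apply: (@filterE nat U) => n; rewrite /= in_itv/=; exact: bdistr_itv.
  by move=> H /(_ H)[l [_ ll]]; exists l.
exists F; split.
- move=> x y xy; rewrite -subr_ge0.
  have H : \forall n \near U, 0 <= (bdistr n.+1 y - bdistr n.+1 x).
    by apply: (@filterE nat U) => n; rewrite subr_ge0 bdistr_mono.
  have := (closed_cvg (fun z : R => 0 <= z) (@closed_ge R 0) H _ (cvgB (HF y) (HF x))). exact.
- move=> t tK; have := HF t; under eq_fun => n do rewrite bdistr_lt//.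
  by move=> /(cvg_lim (@Rhausdorff R)) <-; rewrite lim_cst//; exact: Rhausdorff.
- move=> t tK; have := HF t; under eq_fun => n do rewrite bdistr_ge//.
  by move=> /(cvg_lim (@Rhausdorff R)) <-; rewrite lim_cst//; exact: Rhausdorff.
- move=> P m t c e tt t0 tm H.
  have C1 : \sum_(k < n.+2) bweight n.+1 k * P.[bnode n.+1 k] @[n --> U] --> L P.
    by apply: cvg_trans (@bernstein_cvg P); exact: cvg_fmap2.
  have C2 : \sum_(i < m) c i * (bdistr n.+1 (t i.+1) - bdistr n.+1 (t i)) @[n --> U] -->
      \sum_(i < m) c i * (F (t i.+1) - F (t i)).
    apply: (@cvg_big R 'I_m +%R 0 xpredT add_continuous) => i _.
    by apply: cvgM; [exact: cvg_cst | apply: cvgB; exact: HF].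
  have C := cvg_norm (cvgB C1 C2).
  have N : \forall n \near U, `|\sum_(k < n.+2) bweight n.+1 k * P.[bnode n.+1 k] -
      \sum_(i < m) c i * (bdistr n.+1 (t i.+1) - bdistr n.+1 (t i))| <= e * L 1.
    by apply: (@filterE nat U) => n; exact: bdistr_stieltjes.
  have := closed_cvg (fun z : R => z <= e * L 1) (@closed_le R _) N _ (C _ _).
  exact.
Qed.

End Bernstein.

(** * Right-continuous regularization: a pointwise limit of distribution functions need not be
    right-continuous *)

Section RightLimit.
Variables (R : realType) (F : R -> R).
Hypothesis ndF : {homo F : x y / x <= y}.

Definition right_lim (x : R) : R := inf (F @` [set y | x < y]).

Let has_inf_right x : has_inf (F @` [set y | x < y]).
Proof.
split; first by exists (F (x + 1)); exists (x + 1) => //=; rewrite ltrDl.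
by exists (F x) => _ [y /= xy <-]; exact/ndF/ltW.
Qed.

Lemma right_lim_ge x : F x <= right_lim x.
Proof.
apply: lb_le_inf; first by have [] := has_inf_right x.
by move=> _ [y /= xy <-]; exact/ndF/ltW.
Qed.

Lemma right_lim_le x y : x < y -> right_lim x <= F y.
Proof. by move=> xy; apply: ge_inf; [have [] := has_inf_right x | exists y]. Qed.

Lemma right_lim_adherent x e : 0 < e ->
  exists2 y, x < y & F y < right_lim x + e.
Proof. by move=> /inf_adherent /(_ (has_inf_right x))[_ [y /= xy <-]]; exists y. Qed.

Lemma right_lim_mono : {homo right_lim : x y / x <= y}.
Proof.
move=> x y; rewrite le_eqVlt => /predU1P[->//|xy].
exact: le_trans (right_lim_le xy) (right_lim_ge y).
Qed.

Lemma right_lim_right_continuous x : right_lim @ x^'+ --> right_lim x.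
Proof.
apply/cvgrPdist_lt => e e0; have [y xy Fy] := right_lim_adherent x e0.
near=> z; have xz : x < z by near: z; exact: nbhs_right_gt.
have zy : z < y by near: z; exact: nbhs_right_lt.
have := right_lim_mono (ltW xz); have := right_lim_le zy.
by rewrite ltr_norml => H1 H2; apply/andP; split; lra.
Unshelve. all: by end_near. Qed.

Lemma right_lim_cvg x : F (x + d) @[d --> 0^'+] --> right_lim x.
Proof.
apply/cvgrPdist_lt => e e0; have [y xy Fy] := right_lim_adherent x e0.
near=> d; have d0 : 0 < d by near: d; exact: nbhs_right_gt.
have dy : d < y - x by near: d; apply: nbhs_right_lt; rewrite subr_gt0.
have xd : x < x + d by rewrite ltrDl.
have xdy : x + d <= y by lra.
have := ndF xdy; have := right_lim_le xd.
by rewrite ltr_norml => H1 H2; apply/andP; split; lra.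
Unshelve. all: by end_near. Qed.

End RightLimit.

Lemma cumulative_of (R : realType) (f : R -> R) : {homo f : x y / x <= y} ->
  (forall x, f @ x^'+ --> f x) -> exists g : cumulative R R, g = f :> (R -> R).
Proof.
move=> nd rc; pose m := isCumulative.Build R _ R f nd rc.
by exists (HB.pack_for (cumulative R R) f m).
Qed.

(** The bound [M] is carried for the Horner step, where the Lipschitz constant becomes
    [M + A * B]. *)
Lemma poly_lipschitz (R : realFieldType) (P : {poly R}) (A : R) : 0 <= A ->
  exists M B : R, [/\ 0 <= M, 0 <= B, forall x, `|x| <= A -> `|P.[x]| <= M &
    forall x y, `|x| <= A -> `|y| <= A -> `|P.[x] - P.[y]| <= B * `|x - y|].
Proof.
move=> A0; elim/poly_ind: P => [|P c [M [B [M0 B0 HM HB]]]].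
  by exists 0, 0; split => // x *; rewrite !horner0 ?subrr normr0 ?mul0r.
exists (M * A + `|c|), (M + A * B); split.
- by rewrite addr_ge0 ?mulr_ge0.
- by rewrite addr_ge0 ?mulr_ge0.
- move=> x xA; rewrite hornerMXaddC (le_trans (ler_normD _ _))// lerD2r normrM.
  by rewrite ler_pM// HM.
- move=> x y xA yA; rewrite !hornerMXaddC.
  have -> : P.[x] * x + c - (P.[y] * y + c) = P.[x] * (x - y) + y * (P.[x] - P.[y]) by ring.
  rewrite (le_trans (ler_normD _ _))// !normrM mulrDl -mulrA lerD//.
    by rewrite ler_wpM2r// HM.
  by rewrite ler_pM// HB.
Qed.

(** * Integrals of polynomials against a Lebesgue-Stieltjes measure *)

Section Representation.
Variables (R : realType) (psi : cumulative R R).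
Let mu := lebesgue_stieltjes_measure psi.

Lemma ls_measure_itv (a b : R) : a <= b ->
  mu `]a, b]%classic = (psi b - psi a)%:E.
Proof.
move=> ab; rewrite /mu /lebesgue_stieltjes_measure/= /measure_extension/=.
rewrite measurable_mu_extE; last exact: is_ocitv.
exact: wlength_itv_bnd.
Qed.

Lemma poly_integrable (P : {poly R}) (i : interval R) a b :
  [set` i] `<=` `]a, b]%classic -> a <= b ->
  mu.-integrable [set` i] (EFin \o horner P).
Proof.
move=> iab ab; apply: measurable_bounded_integrable.
- exact: measurable_itv.
- apply: (@le_lt_trans _ _ (mu `]a, b]%classic)).
    by apply: le_measure; [apply/mem_set; exact: measurable_itv|apply/mem_set; exact: measurable_itv|].
  by rewrite ls_measure_itv// ltry.
- exact: measurable_poly.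
- pose C := `|a| + `|b|.
  have [M [_ [_ _ HM _]]] := poly_lipschitz P (addr_ge0 (normr_ge0 a) (normr_ge0 b)).
  exists M; split; first exact: num_real.
  move=> x Mx y /iab /=; rewrite in_itv/= => /andP[ay yb].
  rewrite (le_trans _ (ltW Mx))// HM// ler_norml.
  have := ler_norm b; have := ler_norm (- a); rewrite normrN.
  have := normr_ge0 a; have := normr_ge0 b.
  by move=> *; apply/andP; split; lra.
Qed.

Lemma poly_integral_step (P : {poly R}) (a b c e : R) : a <= b ->
  (forall x, a < x <= b -> `|P.[x] - c| <= e) ->
  (((c - e) * (psi b - psi a))%:E <= \int[mu]_(x in `]a, b]%classic) (P.[x])%:E
    <= ((c + e) * (psi b - psi a))%:E)%E.
Proof.
move=> ab H; have mI : measurable (`]a, b]%classic : set (measurableTypeR R)) by exact: measurable_itv.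
have iP := poly_integrable P (@subset_refl _ `]a, b]%classic) ab.
have ic r : mu.-integrable `]a, b]%classic (cst r%:E).
  have := poly_integrable r%:P (@subset_refl _ `]a, b]%classic) ab.
  by apply: eq_integrable => // x _; rewrite /= hornerC.
have E r : (\int[mu]_(x in `]a, b]%classic) cst r%:E x = (r * (psi b - psi a))%:E)%E.
  by rewrite integral_cst// EFinM -(ls_measure_itv ab).
have HI x : x \in `]a, b]%classic -> c - e <= P.[x] <= c + e.
  move=> /set_mem/= ; rewrite in_itv/= => /H; rewrite ler_norml => /andP[H1 H2].
  by apply/andP; split; lra.
rewrite -!E; apply/andP; split.
  have := le_integral mI (ic (c - e)) iP; apply.
  by move=> x /HI/andP[? _]; rewrite lee_fin.
have := le_integral mI iP (ic (c + e)); apply.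
by move=> x /HI/andP[_ ?]; rewrite lee_fin.
Qed.

Lemma poly_integral_stieltjes (P : {poly R}) (m : nat) (t c : nat -> R) e :
  (forall i, t i <= t i.+1) ->
  (forall i x, (i < m)%N -> t i < x <= t i.+1 -> `|P.[x] - c i| <= e) ->
  ((\sum_(i < m) (c i - e) * (psi (t i.+1) - psi (t i)))%:E <=
     \int[mu]_(x in `]t 0%N, t m]%classic) (P.[x])%:E
    <= (\sum_(i < m) (c i + e) * (psi (t i.+1) - psi (t i)))%:E)%E.
Proof.
move=> tt; elim: m => [|m IH] H.
  by rewrite !big_ord0 set_itv_ge ?bnd_simp ?ltxx// integral_set0 lexx.
have t0m n : t 0%N <= t n by elim: n => // n tn; exact: le_trans (tt n).
have -> : `]t 0%N, t m.+1]%classic = `]t 0%N, t m] `|` `]t m, t m.+1].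
  by apply: itv_bndbnd_setU; rewrite bnd_simp.
have mI (i : interval R) : measurable ([set` i] : set (measurableTypeR R)) by exact: measurable_itv.
rewrite (integral_setU mu (mI _) (mI _))/=.
- have /andP[H1 H2] := IH (fun i x im => H i x (ltnW im)).
  have /andP[H3 H4] := poly_integral_step (tt m) (fun x => H m x (ltnSn m)).
  by rewrite !big_ord_recr/= !EFinD !leeD.
- apply/measurable_realfun.measurable_EFinP; exact: measurable_poly.
- apply/disj_setPS => x /= []; rewrite !in_itv/= => /andP[_ xm] /andP[mx _].
  by move: (lt_le_trans mx xm); rewrite ltxx.
Qed.

(** Countably many null half-open intervals cover the complement. The point [a] is null because
    [psi] is constant up to it; this matters since increments of [psi] describe integrals over
    left-open intervals. *)
Lemma ls_measure_outside (a b : R) : (forall t, t <= a -> psi t = psi a) ->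
  (forall t, b <= t -> psi t = psi b) -> a < b ->
  mu (~` `[a, b]%classic) = 0%E /\ mu [set a] = 0%E.
Proof.
move=> Ha Hb ab.
have Z c d : c <= d -> psi c = psi d -> mu.-negligible `]c, d]%classic.
  move=> cd E; apply/negligibleP; first exact: measurable_itv.
  by apply: etrans (ls_measure_itv cd) _; rewrite E subrr.
have Za c : c <= a -> mu.-negligible `]c, a]%classic by move=> ca; exact: Z (Ha _ ca).
split.
  apply/negligibleP; first by apply: measurableC; exact: measurable_itv.
  have N : mu.-negligible (\bigcup_n (`]a - n%:R, a]%classic `|` `]b, b + n%:R]%classic)).
    apply: negligible_bigcup => n; apply: negligibleU.
      by apply: Za; rewrite gerBl.
    by apply: Z; rewrite ?lerDl// Hb// lerDl.
  apply: negligibleS N; move=> /= x_; pose x : R := x_; rewrite -[x_]/x /=; rewrite in_itv/= => /negP; rewrite negb_and -!ltNge.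
  pose n := (Num.bound `|x - a|%R + Num.bound `|x - b|%R)%N.
  have n1 : `|x - a| < n%:R.
    rewrite (lt_le_trans (archi_boundP (normr_ge0 _)))// ler_nat leq_addr//.
  have n2 : `|x - b| < n%:R.
    rewrite (lt_le_trans (archi_boundP (normr_ge0 _)))// ler_nat leq_addl//.
  case/orP => H; exists n => //; [left|right]; rewrite /= in_itv/=.
    by move: n1; rewrite ltr_norml => /andP[]; move=> *; apply/andP; split; lra.
  by move: n2; rewrite ltr_norml => /andP[]; move=> *; apply/andP; split; lra.
apply/negligibleP; first exact: measurable_set1.
apply: negligibleS (Za (a - 1) _) => [_ ->/=|]; last by rewrite gerBl.
by rewrite in_itv/= lexx andbT ltrBlDr ltrDl.
Qed.

End Representation.

(** * The representing measure of a positive functional *)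

Section MomentProblem.
Variables (R : realType) (K : R) (L : {poly R} -> R).
Hypotheses (K0 : 0 < K) (pL : pos_functional K L).

Let L1 : 0 <= L 1.
Proof. by case: pL => _ sq _; rewrite -[1]mulr1. Qed.

(** The estimate for [F] is applied to the partition shifted by [d], and [d] tends to 0 from the
    right. The margin 1 in [A] keeps the shifted partition starting below [- K]; the tolerance
    [h + h] absorbs a shift [d < h]. *)
Let stieltjes_right_lim (F : R -> R) (P : {poly R}) (m : nat) (A h e : R) (c : nat -> R) :
  A = K + 1 ->
  {homo F : x y / x <= y} ->
  (forall (m : nat) (t c : nat -> R) e,
    (forall i, t i <= t i.+1) -> t 0%N < - K -> K <= t m ->
    (forall i x, (i < m)%N -> t i < x <= t i.+1 -> - K <= x <= K -> `|P.[x] - c i| <= e) ->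
    `|L P - \sum_(i < m) c i * (F (t i.+1) - F (t i))| <= e * L 1) ->
  0 < h -> m%:R * h = A + A ->
  (forall i x, (i < m)%N -> `|x| <= A -> `|x - (- A + i%:R * h)| <= h + h ->
     `|P.[x] - c i| <= e) ->
  `|L P - \sum_(i < m) c i * (right_lim F (- A + i.+1%:R * h) -
      right_lim F (- A + i%:R * h))| <= e * L 1.
Proof.
move=> EA ndF HF h0 mh Hc; pose t i := - A + i%:R * h.
have tS i : t i.+1 = t i + h by rewrite /t -natr1 mulrDl mul1r addrA.
have C1 : \sum_(i < m) c i * (F (t i.+1 + d) - F (t i + d)) @[d --> 0^'+] -->
    \sum_(i < m) c i * (right_lim F (t i.+1) - right_lim F (t i)).
  apply: (@cvg_big R 'I_m +%R 0 xpredT add_continuous) => i _.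
  by apply: cvgM; [exact: cvg_cst | apply: cvgB; exact: right_lim_cvg].
have C := cvg_norm (cvgB (cvg_cst (L P)) C1).
have N : \forall d \near (0 : R)^'+,
    `|L P - \sum_(i < m) c i * (F (t i.+1 + d) - F (t i + d))| <= e * L 1.
  near=> d; have d0 : 0 < d by near: d; exact: nbhs_right_gt.
  have d1 : d < 1 by near: d; exact: nbhs_right_lt.
  have dh : d < h by near: d; exact: nbhs_right_lt.
  apply: (HF m (fun i => t i + d) c e).
  - by move=> i; rewrite tS; lra.
  - by rewrite /t mul0r; lra.
  - by rewrite /t mh; lra.
  - move=> i x im /andP[x1 x2] /andP[Kx xK]; apply: Hc => //.
      by rewrite ler_norml; apply/andP; split; lra.
    by rewrite -/(t i) ler_norml; rewrite tS in x2; apply/andP; split; lra.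
have := closed_cvg (fun z : R => z <= e * L 1) (@closed_le R _) N _ (C _ _ _).
exact.
Unshelve. all: by end_near. Qed.

Lemma moment_measure : exists psi : cumulative R R,
  [/\ {homo psi : x y / x <= y}, forall x, 0 < psi x,
    lebesgue_stieltjes_measure psi (~` `[- (K + 1), K + 1]%classic) = 0%E &
    forall P : {poly R}, (\int[lebesgue_stieltjes_measure psi]_(x in
      `[(- (K + 1))%R, (K + 1)%R]%classic) (P.[x])%:E = (L P)%:E)%E].
Proof.
have [F [ndF F0 F1 HF]] := limit_distr K0 pL.
pose G := right_lim F.
have G0 t : t < - K -> G t = 0.
  move=> tK; apply/eqP; rewrite eq_le; apply/andP; split.
    rewrite -(F0 ((t - K) / 2)); last by lra.
    by apply: right_lim_le => //; lra.
  by rewrite -(F0 t tK); exact: right_lim_ge.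
have G1 t : K <= t -> G t = L 1.
  move=> tK; apply/eqP; rewrite eq_le; apply/andP; split.
    rewrite -(F1 (t + 1)); last by lra.
    by apply: right_lim_le => //; lra.
  by rewrite -(F1 t tK); exact: right_lim_ge.
have Gge t : 0 <= G t.
  have [tK|Kt] := ltP t (- K); first by rewrite G0.
  by rewrite -(G0 (- K - 1)); [apply: right_lim_mono => //; lra | lra].
(* The constant 1 makes [psi] positive left of [- K] as well; the increments, hence the measure, are
   unchanged. *)
have [psi Epsi] : exists g : cumulative R R, g = (fun x => G x + 1) :> (R -> R).
  apply: cumulative_of => [x y xy|x]; first by rewrite lerD2r; exact: right_lim_mono.
  by apply: cvgD; [exact: right_lim_right_continuous | exact: cvg_cst].
have Ed x y : psi x - psi y = G x - G y by rewrite Epsi; lra.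
have [A EA] : exists A : R, A = K + 1 by exists (K + 1).
have A0 : 0 < A by rewrite EA addr_gt0.
have psiN t : t <= - A -> psi t = psi (- A) by move=> tA; rewrite Epsi !G0//; lra.
have psiP t : A <= t -> psi t = psi A by move=> tA; rewrite Epsi !G1//; lra.
have AA0 : - A < A by lra.
have [mu1 mu2] := ls_measure_outside psiN psiP AA0.
exists psi; rewrite -EA; split => //.
- by move=> x y xy; rewrite Epsi lerD2r; exact: right_lim_mono.
- by move=> x; rewrite Epsi ltr_wpDl.
move=> P.
set mu := lebesgue_stieltjes_measure psi.
have mI (i : interval R) : measurable ([set` i] : set (measurableTypeR R)).
  exact: measurable_itv.
have sub (b : bool) : [set` Interval (BSide b (- A)) (BRight A)] `<=` `](- A - 1), A]%classic.
  move=> x /=; rewrite !in_itv/= => /andP[Ax ->]; rewrite andbT.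
  by case: b Ax => /= Ax; lra.
have AA : - A - 1 <= A by lra.
have iP b := @poly_integrable R psi P _ _ _ (@sub b) AA.
have -> : (\int[mu]_(x in `[(- A)%R, A]%classic) (P.[x])%:E =
    \int[mu]_(x in `](- A)%R, A]%classic) (P.[x])%:E)%E.
  have mA : measurable ([set (- A)] : set (measurableTypeR R)) by exact: measurable_set1.
  have := negligible_integral mA (mI _) (iP true) mu2.
  by rewrite setDitv1l.
have fin := integrable_fin_num (mI _) (iP false).
set I := (X in X = _); have EI : I = (fine I)%:E by rewrite fineK.
(* One [e * L 1] compares the integral with the Stieltjes sum [SP], the other compares [SP] with
   [L P]. *)
suff close e : 0 < e -> `|fine I - L P| <= 2 * (e * L 1).
  rewrite EI; congr (_%:E); apply/eqP; rewrite -subr_eq0 -normr_eq0 eq_le normr_ge0 andbT.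
  rewrite leNgt; apply/negP => H.
  have L1' : 0 < 4 * (L 1 + 1) by have := L1; lra.
  (* This [e] pushes the bound below half the difference; the added 1 covers [L 1 = 0]. *)
  have := close (`|fine I - L P| / (4 * (L 1 + 1))) (divr_gt0 H L1').
  move: (`|fine I - L P|) H => z z0.
  have -> : 2 * (z / (4 * (L 1 + 1)) * L 1) = z * (2 * L 1 / (4 * (L 1 + 1))) by ring.
  have : 2 * L 1 / (4 * (L 1 + 1)) < 1 by rewrite ltr_pdivrMr// mul1r; have := L1; lra.
  by move=> lt1; rewrite leNgt -[X in _ < X]mulr1 ltr_pM2l ?lt1.
move=> e0.
have [M [B [M0 B0 _ HB]]] := poly_lipschitz P (ltW A0).
(* Fine enough for [P] to vary by at most [e] over two mesh steps. *)
pose m := (Num.bound (4 * A * (B + 1) / e)).+1.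
pose h := (A + A) / m%:R.
have m0 : 0 < m%:R :> R by rewrite ltr0n.
have h0 : 0 < h by rewrite divr_gt0// addr_gt0.
have mh : m%:R * h = A + A by rewrite mulrC divfK// gt_eqF.
have hB : B * (h + h) <= e.
  have : 4 * A * (B + 1) / e < m%:R.
    apply: (@lt_trans _ _ (Num.bound (4 * A * (B + 1) / e))%:R); last by rewrite ltr_nat.
    by apply: archi_boundP; rewrite divr_ge0// ?mulr_ge0// ?addr_ge0// ltW.
  rewrite ltr_pdivrMr// => H; rewrite -(ler_pM2l m0).
  have -> : m%:R * (B * (h + h)) = 2 * B * (m%:R * h) by ring.
  rewrite mh; apply: le_trans (ltW H); have : 0 <= A * B by rewrite mulr_ge0// ltW.
  by lra.
pose t i := - A + i%:R * h.
have tS i : t i.+1 = t i + h by rewrite /t -natr1 mulrDl mul1r addrA.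
have tt i : t i <= t i.+1 by rewrite tS; lra.
have t0 : t 0%N = - A by rewrite /t mul0r addr0.
have tm : t m = A by rewrite /t mh addKr.
have tA i : (i <= m)%N -> `|t i| <= A.
  move=> im; rewrite ler_norml /t; have i0 : 0 <= i%:R * h by rewrite mulr_ge0// ltW.
  have : i%:R * h <= A + A by rewrite -mh; apply: ler_wpM2r; [exact: ltW | rewrite ler_nat].
  by move=> *; apply/andP; split; lra.
have Hc i x : (i < m)%N -> `|x| <= A -> `|x - t i| <= h + h -> `|P.[x] - P.[t i]| <= e.
  move=> im xA xt; apply: le_trans (HB _ _ xA (tA _ (ltnW im))) _; apply: le_trans hB.
  by rewrite ler_wpM2l.
have := @stieltjes_right_lim F P m A h e (fun i => P.[t i]) EA ndF (HF P) h0 mh Hc.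
rewrite -/G -/t; set SP := \sum_(i < m) _ => S1.
have := @poly_integral_stieltjes _ psi P m t (fun i => P.[t i]) e tt.
have E (s : R) : \sum_(i < m) (P.[t i] + s) * (psi (t i.+1) - psi (t i)) = SP + s * L 1.
  rewrite -[L 1]subr0 -(G1 (t m)); last by rewrite tm; lra.
  rewrite -{2}(G0 (t 0%N)); last by rewrite t0; lra.
  rewrite -(telescope_sumr (fun i => G (t i)))// big_mkord mulr_sumr -big_split.
  by apply: eq_bigr => i _ /=; rewrite Ed mulrDl.
rewrite (E e) (E (- e)) t0 tm -/mu -/I EI !lee_fin => S2.
have /andP[H1 H2] : SP + - e * L 1 <= fine I <= SP + e * L 1.
  apply: S2 => i x im /andP[x1 x2]; apply: Hc => //.
    have := tA _ im; have := tA _ (ltnW im); rewrite !ler_norml.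
    by move=> /andP[? ?] /andP[? ?]; apply/andP; split; lra.
  by rewrite tS in x2; rewrite ler_norml; apply/andP; split; lra.
by move: S1; rewrite !ler_norml => /andP[? ?]; apply/andP; split; lra.
Qed.

End MomentProblem.

(** * Transposition of the right data, and the conclusion *)

Lemma lower_TP_tr (R : realType) n (M : 'M[R]_n) :
  lower_unitriangular_TP M -> upper_unitriangular_TP M^T.
Proof.
move=> [tM dM pM]; split; first by rewrite /upper_triangular trmxK.
  by move=> i; rewrite mxE.
move=> r f g incf incg fg; rewrite -det_tr.
have -> : (mxsub f g M^T)^T = mxsub g f M by apply/matrixP => i j; rewrite !mxE.
exact: pM.
Qed.

Lemma right_recursion_tr (R : realType) q (T : smx R) B0 (B : nat -> 'I_q -> {poly R}) :
  right_recursion_polys T B0 B ->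
  left_recursion_polys (smx_tr T) B0^T (fun b n => B n b).
Proof.
move=> [tB uB BE BT]; split => //; first by rewrite /upper_triangular trmxK.
  by rewrite unitmx_tr.
  by move=> a n; rewrite BE mxE.
by move=> a n; exact: BT.
Qed.

Lemma smx_tr_shift (R : realType) (T : smx R) s :
  smx_tr (smx_shift T s) = smx_shift (smx_tr T) s.
Proof.
by apply/funext => i; apply/funext => j; rewrite /smx_tr /smx_shift /smx1 eq_sym.
Qed.

Theorem theorem3p11 (R : realType) (p q : nat) (hp : (1 <= p)%N)
  (hq : (1 <= q)%N) (T : smx R) (hT : banded p q T)
  (hbounded : bounded_operator T)
  (s : R) (hs : 0 <= s) (L : nat -> smx R) (D : smx R) (U : nat -> smx R)
  (hPBF : is_PBF p q (smx_shift T s) L D U)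
  (A0 : 'M[R]_p) (A : 'I_p -> nat -> {poly R})
  (hA : left_recursion_polys T A0 A)
  (B0 : 'M[R]_q) (B : nat -> 'I_q -> {poly R})
  (hB : right_recursion_polys T B0 B)
  (calA : 'M[R]_p) (hcalA : upper_unitriangular_TP calA)
  (calB : 'M[R]_q) (hcalB : lower_unitriangular_TP calB)
  (hA0 : invmx A0 = Lambda_mx p L *m calA)
  (hB0 : invmx B0 = calB *m Upsilon_mx q U) :
  (exists (psi : 'I_q -> 'I_p -> cumulative R R) (Delta : set R),
     [/\ forall b a, {homo psi b a : x y / x <= y},
         forall b a x, 0 < psi b a x,
         compact Delta,
         forall b a, lebesgue_stieltjes_measure (psi b a) (~` Delta) = 0%E &
         forall k l : nat,
           (\sum_(a < p) \sum_(b < q)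
              \int[lebesgue_stieltjes_measure (psi b a)]_(x in Delta)
                ((B l b).[x] * (A a k).[x])%:E
            = ((k == l)%:R : R)%:E)%E]) /\
  (forall (n : nat) (a : 'I_p), degz (A a n) = step_degree n a.+1 p) /\
  (forall (n : nat) (b : 'I_q), degz (B n b) = step_degree n b.+1 q).
Proof.
have bR i j : (i + q < j)%N -> T i j = 0 by move=> ij; rewrite hT ?ij.
have bL i j : (j + p < i)%N -> T i j = 0 by move=> ij; rewrite hT ?ij ?orbT.
have fT : rfin T by move=> i; exists (i + q).+1 => k; exact: bR.
have dS := PBF_left_data hPBF.
have hPBFt := PBF_tr hPBF; have dS' := PBF_left_data hPBFt.
have tB := lower_TP_tr hcalB.
have hB0t : invmx B0^T = Lambda_mx q (fun i => smx_tr (U i)) *m calB^T.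
  by rewrite -trmx_inv hB0 trmx_mul (Upsilon_tr hPBF).
split; last first.
  split; first exact: (left_degrees hp dS hcalA erefl bL hA hA0).
  move=> n b.
  apply: (left_degrees hq dS' tB (smx_tr_shift T s) _ (right_recursion_tr hB) hB0t).
  by move=> i j; exact: bR.
(* Since [p >= 1] this entry is off the diagonal, where [T] and its shift agree. *)
have nTp n : T (n + p)%N n != 0.
  have := left_data_gt0 hp dS hcalA n; rewrite /smx_shift /smx1.
  by rewrite gtn_eqF ?mulr0 ?addr0 => [/lt0r_neq0//|]; rewrite -{1}[n]addn0 ltn_add2l.
have nTq n : T n (n + q)%N != 0.
  have := left_data_gt0 hq dS' tB n; rewrite /smx_tr /smx_shift /smx1.
  by rewrite ltn_eqF ?mulr0 ?addr0 => [/lt0r_neq0//|]; rewrite -{1}[n]addn0 ltn_add2l.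
have [K K1 HK] := moment_fun_growth (invmx A0) (invmx B0) hT hbounded.
have K0 : 0 < K by apply: lt_le_trans K1.
have pL b a : pos_functional K (moment_fun T (invmx A0) (invmx B0) b a).
  split; [exact: moment_fun_lin| |exact: HK].
  move=> P; rewrite hA0; apply: (moment_fun_sqr_ge0 b a P fT dS dS' hcalA tB).
  by rewrite trmx_inv.
have /choice[psi Hpsi] := fun ba : 'I_q * 'I_p => moment_measure K0 (pL ba.1 ba.2).
exists (fun b a => psi (b, a)), `[(- (K + 1)), K + 1]%classic; split.
- by move=> b a; have [] := Hpsi (b, a).
- by move=> b a; have [] := Hpsi (b, a).
- exact: segment_compact.
- by move=> b a; have [] := Hpsi (b, a).
- move=> k l; rewrite -(biorthogonality hp hq hT fT hA hB nTp nTq k l).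
  rewrite -sumEFin; apply: eq_bigr => a _; rewrite -sumEFin; apply: eq_bigr => b _.
  have [_ _ _ <-] := Hpsi (b, a).
  by apply: eq_integral => x _; rewrite hornerM.
Qed.
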